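(* Let $k$ be a field and let $n\geq2$ be an integer. Let $\mathcal{C}$ be a skeletally small, $k$-linear, $\operatorname{Hom}$-finite, idempotent complete, triangulated category with suspension functor $\Sigma$ and a Serre functor. Let $\mathcal{X}\subseteq\mathcal{T}$ be additive, contravariantly finite subcategories of $\mathcal{C}$ such that $\mathcal{T}$ is a locally bounded, $n$-cluster tilting subcategory of $\mathcal{C}$, and let $\mathcal{Y}\subseteq\mathcal{C}$ be the additive, rigid subcategory, closed under direct summands, defined by $\operatorname{indec}\mathcal{T}=\operatorname{indec}\mathcal{X}\,\dot\cup\,\operatorname{indec}\mathcal{Y}$. Then the canonical surjection $Q\colon K_0(\mathcal{C},\mathbb{E}_{\mathcal{T}},\mathfrak{s}_{\mathcal{T}})\to K_0(\mathcal{C},\mathbb{E}_{\mathcal{X}},\mathfrak{s}_{\mathcal{X}})$, $[C]_{\mathcal{T}}\mapsto[C]_{\mathcal{X}}$, satisfies $$\operatorname{Ker}Q=\Big\langle\,\sum_{i=0}^{n+1}(-1)^i[T_i]_{\mathcal{T}}\ \Big|\ T_0=Y\in\operatorname{indec}\mathcal{Y}\text{ and }T_{n+1}\to T_n\to\cdots\to T_1\to T_0\text{ is an Auslander-Reiten }(n+2)\text{-angle in }\mathcal{T}\Big\rangle,$$ where $\langle\,\cdot\,\rangle$ denotes the subgroup generated.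
   Context: An additive subcategory of $\mathcal{C}$ is a full subcategory closed under isomorphisms, (finite) direct sums and direct summands. A full subcategory $\mathcal{D}$ is rigid if $\mathcal{C}(D,\Sigma D')=0$ for all $D,D'\in\mathcal{D}$. A right $\mathcal{D}$-approximation of $A\in\mathcal{C}$ is a morphism $\xi\colon D\to A$ with $D\in\mathcal{D}$ such that $\mathcal{C}(D',\xi)$ is surjective for every $D'\in\mathcal{D}$; left $\mathcal{D}$-approximations are dual. $\mathcal{D}$ is contravariantly finite if every $A\in\mathcal{C}$ has a right $\mathcal{D}$-approximation. $\operatorname{indec}\mathcal{A}$ denotes the class of indecomposable objects in a fixed skeleton of $\mathcal{A}$, where skeletons of subcategories are chosen inside a fixed skeleton of $\mathcal{C}$. $\mathcal{T}$ is $n$-cluster tilting if it is functorially finite in $\mathcal{C}$ and $$\mathcal{T}=\{X\in\mathcal{C}\mid \mathcal{C}(\mathcal{T},\Sigma^iX)=0\text{ for }1\leq i\leq n-1\}=\{X\in\mathcal{C}\mid \mathcal{C}(X,\Sigma^i\mathcal{T})=0\text{ for }1\leq i\leq n-1\}.$$ $\mathcal{T}$ is locally bounded if it is $\operatorname{Hom}$-finite and for each indecomposable $T\in\mathcal{T}$ there are only finitely many $T'\in\operatorname{indec}\mathcal{T}$ with $\mathcal{T}(T,T')\neq0$ or $\mathcal{T}(T',T)\neq0$. $K_0^{\mathrm{sp}}(\mathcal{C})$ is the split Grothendieck group of $\mathcal{C}$ (generated by isomorphism classes $[C]^{\mathrm{sp}}_{\mathcal{C}}$ modulo $[A\oplus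 B]^{\mathrm{sp}}_{\mathcal{C}}=[A]^{\mathrm{sp}}_{\mathcal{C}}+[B]^{\mathrm{sp}}_{\mathcal{C}}$). For $\mathcal{D}\in\{\mathcal{X},\mathcal{T}\}$, $K_0(\mathcal{C},\mathbb{E}_{\mathcal{D}},\mathfrak{s}_{\mathcal{D}})$ is the Grothendieck group of the relative extriangulated category whose extriangles are the triangles $A\to B\to C\xrightarrow{\delta}\Sigma A$ in $\mathcal{C}$ with $\mathcal{C}(-,\delta)|_{\mathcal{D}}=0$; explicitly it is $K_0^{\mathrm{sp}}(\mathcal{C})/\mathcal{I}_{\mathcal{D}}$, where $\mathcal{I}_{\mathcal{D}}$ is the subgroup generated by all $[A]^{\mathrm{sp}}_{\mathcal{C}}-[B]^{\mathrm{sp}}_{\mathcal{C}}+[C]^{\mathrm{sp}}_{\mathcal{C}}$ arising from such triangles. The class of $C$ is denoted $[C]_{\mathcal{D}}$. Since $\mathcal{X}\subseteq\mathcal{T}$, one has $\mathcal{I}_{\mathcal{T}}\subseteq\mathcal{I}_{\mathcal{X}}$, so $Q$ is well defined. An Auslander-Reiten $(n+2)$-angle $T_{n+1}\to T_n\to\cdots\to T_1\to T_0$ in $\mathcal{T}$ amounts to objects $T_0,\dots,T_{n+1}\in\mathcal{T}$ and $X_{1.5},\dots,X_{n-0.5}\in\mathcal{C}$, together with triangles in $\mathcal{C}$ $$X_{i+0.5}\xrightarrow{\alpha_{i+0.5}}T_i\xrightarrow{\beta_i}X_{i-0.5}\xrightarrow{\gamma_{i-0.5}}\Sigma X_{i+0.5}\qquad(1\leq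 i\leq n),$$ where $X_{0.5}:=T_0$, $X_{n+0.5}:=T_{n+1}$ and $\alpha_{n+0.5}$ is denoted $\beta_{n+1}\colon T_{n+1}\to T_n$, such that: $\beta_1$ is minimal right almost split in $\mathcal{T}$; $\beta_{n+1}$ is minimal left almost split in $\mathcal{T}$; $\beta_2,\dots,\beta_n$ are minimal right $\mathcal{T}$-approximations; and $\alpha_{1.5},\dots,\alpha_{n-0.5}$ are minimal left $\mathcal{T}$-approximations. The maps $T_{i+1}\to T_i$ in the $(n+2)$-angle are $\beta_{n+1}$, $\alpha_{i+0.5}\beta_{i+1}$ for $1\leq i\leq n-1$, and $\beta_1$. *)

(* Defs.v *)
From HB Require Import structures.
From mathcomp Require Import all_boot all_order all_algebra.
From mathcomp Require Import generic_quotient ring_quotient.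
From mathcomp Require Import boolp.
From mathcomp Require Import freeg.

Set Implicit Arguments.
Unset Strict Implicit.
Unset Printing Implicit Defensive.

Import GRing.Theory.
Local Open Scope ring_scope.
Local Open Scope quotient_scope.

Reserved Notation "g \co f" (at level 40, left associativity).

Record lincat (k : fieldType) := LinCat {
  obj :> Type;
  hom : obj -> obj -> lmodType k;
  idm : forall A, hom A A;
  comp : forall A B C, hom B C -> hom A B -> hom A C;
  comp_idl : forall A B (f : hom A B), comp (idm B) f = f;
  comp_idr : forall A B (f : hom A B), comp f (idm A) = f;
  comp_assoc : forall A B C D (h : hom C D) (g : hom B C) (f : hom A B),
    comp h (comp g f) = comp (comp h g) f;
  comp_linearl : forall A B C (f : hom A B),
    linear (fun g : hom B C => comp g f);
  comp_linearr : forall A B C (g : hom B C),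
    linear (fun f : hom A B => comp g f)
}.

Arguments hom {k l}.
Arguments idm {k l}.
Arguments comp {k l A B C}.
Notation "g \co f" := (comp g f) : ring_scope.

Section LinearCategory.
Variables (k : fieldType) (C : lincat k).
Implicit Types (A B X Z : C).

Definition is_iso A B (f : hom A B) : Prop :=
  exists g : hom B A, g \co f = idm A /\ f \co g = idm B.

Definition isomorphic A B : Prop := exists f : hom A B, is_iso f.

Definition is_zero Z : Prop := idm Z = 0.

Definition is_biproduct A B X : Prop :=
  exists (i1 : hom A X) (i2 : hom B X) (p1 : hom X A) (p2 : hom X B),
    [/\ p1 \co i1 = idm A, p2 \co i2 = idm B, p1 \co i2 = 0, p2 \co i1 = 0
      & i1 \co p1 + i2 \co p2 = idm X].

Definition split_mono A B (f : hom A B) : Prop :=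
  exists g : hom B A, g \co f = idm A.

Definition split_epi A B (f : hom A B) : Prop :=
  exists g : hom B A, f \co g = idm B.

Definition idempotent_complete : Prop :=
  forall A (e : hom A A), e \co e = e ->
    exists B (r : hom A B) (s : hom B A), s \co r = e /\ r \co s = idm B.

Definition indecomposable X : Prop :=
  ~ is_zero X /\
  forall A B, is_biproduct A B X -> is_zero A \/ is_zero B.

(** Full subcategories are given by their classes of objects. *)
Definition subcategory := C -> Prop.

Definition sub_incl (D E : subcategory) : Prop := forall A, D A -> E A.

Definition hom_finite_on (D : subcategory) : Prop :=
  forall A B, D A -> D B ->
    exists (d : nat) (b : 'I_d -> hom A B),
      forall f : hom A B, exists c : 'I_d -> k, f = \sum_i c i *: b i.

Definition hom_finite : Prop := hom_finite_on (fun=> True).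

(** Closure under finite direct sums is split into the empty and the binary
    case. *)
Definition additive_subcategory (D : subcategory) : Prop :=
  [/\ forall A B, isomorphic A B -> D A -> D B,
      forall Z, is_zero Z -> D Z,
      forall A B X, is_biproduct A B X -> D A -> D B -> D X
    & forall A B X, is_biproduct A B X -> D X -> D A /\ D B].

Definition right_minimal A B (f : hom A B) : Prop :=
  forall g : hom A A, f \co g = f -> is_iso g.

Definition left_minimal A B (f : hom A B) : Prop :=
  forall g : hom B B, g \co f = f -> is_iso g.

Definition right_approximation (D : subcategory) A B (f : hom A B) : Prop :=
  D A /\ forall A' (h : hom A' B), D A' -> exists g : hom A' A, h = f \co g.

Definition left_approximation (D : subcategory) A B (f : hom A B) : Prop :=
  D B /\ forall B' (h : hom A B'), D B' -> exists g : hom B B', h = g \co f.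

Definition contravariantly_finite (D : subcategory) : Prop :=
  forall A, exists A' (f : hom A' A), right_approximation D f.

Definition covariantly_finite (D : subcategory) : Prop :=
  forall A, exists A' (f : hom A A'), left_approximation D f.

Definition functorially_finite (D : subcategory) : Prop :=
  contravariantly_finite D /\ covariantly_finite D.

Definition right_almost_split (D : subcategory) A B (f : hom A B) : Prop :=
  [/\ D A, D B, ~ split_epi f
    & forall A' (h : hom A' B), D A' -> ~ split_epi h ->
        exists g : hom A' A, h = f \co g].

Definition left_almost_split (D : subcategory) A B (f : hom A B) : Prop :=
  [/\ D A, D B, ~ split_mono f
    & forall B' (h : hom A B'), D B' -> ~ split_mono h ->
        exists g : hom B B', h = g \co f].

Record linfunctor := LinFunctor {
  fobj :> C -> C;
  fmap : forall A B, hom A B -> hom (fobj A) (fobj B);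
  fmap_id : forall A, fmap (idm A) = idm (fobj A);
  fmap_comp : forall A B D (g : hom B D) (f : hom A B),
    fmap (g \co f) = fmap g \co fmap f;
  fmap_linear : forall A B, linear (@fmap A B)
}.

(** An equivalence is a functor with a quasi-inverse: [u] and [v] are natural
    isomorphisms [G F -> 1] and [F G -> 1]. *)
Definition is_equivalence (F : linfunctor) : Prop :=
  exists (G : linfunctor)
    (u : forall A, hom (G (F A)) A) (v : forall A, hom (F (G A)) A),
    [/\ forall A, is_iso (u A),
        forall A, is_iso (v A),
        forall A B (f : hom A B), f \co u A = u B \co fmap G (fmap F f)
      & forall A B (f : hom A B), f \co v A = v B \co fmap F (fmap G f)].

(** [serre_iso A B] is an isomorphism [C(B, S A) -> Hom_k(C(A, B), k)], natural
    in [A] and [B]. *)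
Record serre_functor := SerreFunctor {
  serre :> linfunctor;
  serre_equivalence : is_equivalence serre;
  serre_iso : forall A B, hom B (serre A) -> {scalar (hom A B)};
  serre_iso_linear : forall A B (c : k) (g h : hom B (serre A)) (f : hom A B),
    serre_iso (c *: g + h) f = c * serre_iso g f + serre_iso h f;
  serre_iso_bijective : forall A B (phi : {scalar (hom A B)}),
    exists! g : hom B (serre A), serre_iso g =1 phi;
  serre_iso_natural : forall A A' B B' (a : hom A' A) (b : hom B B')
      (f : hom A B) (g : hom B' (serre A')),
    serre_iso g (b \co f \co a) = serre_iso (fmap serre a \co g \co b) f
}.

(** Isomorphism classes of objects are indexed by a type of the universe of
    [choiceType], in which the morphism spaces live as well; the type of all
    objects may be larger. Having a skeleton thus is being skeletally small. *)
Record skeleton := Skeleton {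
  sk_index :> choiceType;
  sk_obj : sk_index -> C;
  sk_surj : forall A, exists i, isomorphic A (sk_obj i);
  sk_inj : forall i j, isomorphic (sk_obj i) (sk_obj j) -> i = j
}.

Definition sk_class (sk : skeleton) A : sk := sval (cid (sk_surj sk A)).

Definition indec (sk : skeleton) (D : subcategory) (i : sk) : Prop :=
  D (sk_obj i) /\ indecomposable (sk_obj i).

Definition locally_bounded (sk : skeleton) (D : subcategory) : Prop :=
  hom_finite_on D /\
  forall A, D A -> indecomposable A ->
    exists s : seq sk, forall i, indec D i ->
      (exists f : hom A (sk_obj i), f != 0) \/
      (exists f : hom (sk_obj i) A, f != 0) ->
      i \in s.

End LinearCategory.

Arguments sk_obj {k C s}.
Arguments indec {k C sk}.
Arguments is_equivalence {k C}.

Record tricat (k : fieldType) := TriCat {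
  tri_cat :> lincat k;
  zero_exists : exists Z : tri_cat, is_zero Z;
  biproduct_exists : forall A B : tri_cat, exists X, is_biproduct A B X;
  susp : linfunctor tri_cat;
  susp_equivalence : is_equivalence susp;
  triangle : forall A B C : tri_cat,
    hom A B -> hom B C -> hom C (susp A) -> Prop;
  triangle_iso : forall (A B C A' B' C' : tri_cat)
      (f : hom A B) (g : hom B C) (h : hom C (susp A))
      (f' : hom A' B') (g' : hom B' C') (h' : hom C' (susp A'))
      (a : hom A A') (b : hom B B') (c : hom C C'),
    is_iso a -> is_iso b -> is_iso c ->
    b \co f = f' \co a -> c \co g = g' \co b -> fmap susp a \co h = h' \co c ->
    triangle f g h -> triangle f' g' h';
  triangle_id : forall A Z : tri_cat, is_zero Z ->
    triangle (idm A) (0 : hom A Z) (0 : hom Z (susp A));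
  triangle_cone : forall (A B : tri_cat) (f : hom A B),
    exists C (g : hom B C) (h : hom C (susp A)), triangle f g h;
  triangle_rotate : forall (A B C : tri_cat)
      (f : hom A B) (g : hom B C) (h : hom C (susp A)),
    triangle f g h <-> triangle g h (- fmap susp f);
  triangle_fill : forall (A B C A' B' C' : tri_cat)
      (f : hom A B) (g : hom B C) (h : hom C (susp A))
      (f' : hom A' B') (g' : hom B' C') (h' : hom C' (susp A'))
      (a : hom A A') (b : hom B B'),
    triangle f g h -> triangle f' g' h' -> b \co f = f' \co a ->
    exists c : hom C C', c \co g = g' \co b /\ fmap susp a \co h = h' \co c;
  triangle_octahedral : forall (A B C D E F : tri_cat)
      (f : hom A B) (f' : hom B D) (f'' : hom D (susp A))
      (g : hom B C) (g' : hom C E) (g'' : hom E (susp B))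
      (h' : hom C F) (h'' : hom F (susp A)),
    triangle f f' f'' -> triangle g g' g'' -> triangle (g \co f) h' h'' ->
    exists (u : hom D F) (v : hom F E),
      [/\ triangle u v (fmap susp f' \co g''),
          u \co f' = h' \co g, h'' \co u = f'', v \co h' = g'
        & g'' \co v = fmap susp f \co h'']
}.

Arguments susp {k} t : rename.
Arguments triangle {k t A B C}.

Section Triangulated.
Variables (k : fieldType) (C : tricat k).

Definition rigid (D : subcategory C) : Prop :=
  forall A B, D A -> D B -> forall f : hom A (susp C B), f = 0.

(** A fixpoint of its own, as [iter] would force the type of objects into the
    universe of [choiceType]. *)
Fixpoint susp_iter (i : nat) (X : C) : C :=
  if i is j.+1 then susp C (susp_iter j X) else X.

Definition cluster_tilting (n : nat) (T : subcategory C) : Prop :=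
  [/\ functorially_finite T,
      forall X, T X <->
        (forall i, (1 <= i <= n - 1)%N ->
         forall A, T A -> forall f : hom A (susp_iter i X), f = 0)
    & forall X, T X <->
        (forall i, (1 <= i <= n - 1)%N ->
         forall A, T A -> forall f : hom X (susp_iter i A), f = 0)].

(** With [X_{j+0.5}] written [ar_half j] and [T_{i+1}] written [ar_mid i], the
    triangle with index [i + 1] is
    [ar_half i.+1 -> ar_mid i -> ar_half i -> susp (ar_half i.+1)] for [i < n].
    The end terms are [T_0 = ar_half 0] and [T_{n+1} = ar_half n]. Only the
    [ar_half j] with [j <= n] and the [ar_mid i] with [i < n] (and the maps
    between them) are part of the (n+2)-angle; the other values carry no
    information. *)
Record ar_angle (T : subcategory C) (n : nat) := ArAngle {
  ar_half : nat -> C;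
  ar_mid : nat -> C;
  ar_alpha : forall i, hom (ar_half i.+1) (ar_mid i);
  ar_beta : forall i, hom (ar_mid i) (ar_half i);
  ar_gamma : forall i, hom (ar_half i) (susp C (ar_half i.+1));
  ar_first : T (ar_half 0);
  ar_last : T (ar_half n);
  ar_middle : forall i, (i < n)%N -> T (ar_mid i);
  ar_triangle : forall i, (i < n)%N ->
    triangle (ar_alpha i) (ar_beta i) (ar_gamma i);
  ar_beta_first :
    right_almost_split T (ar_beta 0) /\ right_minimal (ar_beta 0);
  ar_alpha_last : forall i, i.+1 = n ->
    left_almost_split T (ar_alpha i) /\ left_minimal (ar_alpha i);
  ar_beta_approximation : forall i, (0 < i < n)%N ->
    right_approximation T (ar_beta i) /\ right_minimal (ar_beta i);
  ar_alpha_approximation : forall i, (i.+1 < n)%N ->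
    left_approximation T (ar_alpha i) /\ left_minimal (ar_alpha i)
}.

(** The object [T_i], for [0 <= i <= n + 1]. *)
Definition ar_obj (T : subcategory C) (n : nat) (a : ar_angle T n) (i : nat) :
    C :=
  if i is j.+1 then (if j == n then ar_half a n else ar_mid a j)
  else ar_half a 0.

End Triangulated.

Section Generated.
Variables (G : zmodType) (S : G -> Prop).

Inductive generated : G -> Prop :=
| generated_in x : S x -> generated x
| generated0 : generated 0
| generatedB x y : generated x -> generated y -> generated (x - y).

Definition generated_pred : {pred G} := fun x => `[< generated x >].

Fact generated_pred_zmod_closed : zmod_closed generated_pred.
Proof.
split=> [|x y]; first by apply/asboolP; exact: generated0.
by move=> /asboolP gx /asboolP gy; apply/asboolP; exact: generatedB.
Qed.

HB.instance Definition _ :=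
  GRing.isZmodClosed.Build G generated_pred generated_pred_zmod_closed.

Definition quotient_by : zmodType := Quotient.quot generated_pred.

End Generated.

Section Grothendieck.
Variables (k : fieldType) (C : tricat k) (sk : skeleton C).

Definition split_relation (z : {freeg sk / int}) : Prop :=
  exists A B X : C, is_biproduct A B X /\
    z = << sk_class sk X >> - << sk_class sk A >> - << sk_class sk B >>.

Definition K0sp : zmodType := quotient_by split_relation.

Definition class_sp (A : C) : K0sp :=
  \pi_(Quotient.quot (generated_pred split_relation)) << sk_class sk A >>.

Definition relative_triangle (D : subcategory C) (A B E : C)
    (f : hom A B) (g : hom B E) (delta : hom E (susp C A)) : Prop :=
  triangle f g delta /\
  forall D' (h : hom D' E), D D' -> delta \co h = 0.

Definition relative_relation (D : subcategory C) (z : K0sp) : Prop :=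
  exists (A B E : C) (f : hom A B) (g : hom B E) (delta : hom E (susp C A)),
    relative_triangle D f g delta /\
    z = class_sp A - class_sp B + class_sp E.

Definition K0 (D : subcategory C) : zmodType :=
  quotient_by (relative_relation D).

Definition K0_proj (D : subcategory C) (x : K0sp) : K0 D :=
  \pi_(Quotient.quot (generated_pred (relative_relation D))) x.

Definition K0_class (D : subcategory C) (A : C) : K0 D := K0_proj D (class_sp A).

Fact K0_proj_is_zmod_morphism (D : subcategory C) :
  zmod_morphism (K0_proj D).
Proof. exact: (raddfB \pi_(Quotient.quot _)). Qed.

HB.instance Definition _ (D : subcategory C) :=
  GRing.isZmodMorphism.Build K0sp (K0 D) (K0_proj D)
    (K0_proj_is_zmod_morphism D).

Lemma K0_projP (D : subcategory C) (x y : K0sp) :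
  K0_proj D x = K0_proj D y <-> generated (relative_relation D) (x - y).
Proof.
by split=> [/eqP|g]; [|apply/eqP]; rewrite -[_ == _]Quotient.idealrBE;
  [move/asboolP|apply/asboolP].
Qed.

Lemma relative_relation_anti (D E : subcategory C) (z : K0sp) :
  sub_incl D E ->
  generated (relative_relation E) z -> generated (relative_relation D) z.
Proof.
move=> DE; elim=> [x|| x y _ gx _ gy]; last exact: generatedB; last first.
  exact: generated0.
move=> [A [B [X [f [g [d [[tr tr0] ->]]]]]]]; apply: generated_in.
exists A, B, X, f, g, d; split=> //; split=> // D' h /DE; exact: tr0.
Qed.

(** By [canonicalE] this does not depend on the representative. It is additive
    and, by [canonical_surj], surjective. *)
Definition canonical (D E : subcategory C) (DE : sub_incl D E) (x : K0 E) :
    K0 D :=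
  K0_proj D (repr (x : Quotient.quot (generated_pred (relative_relation E)))).

Section Canonical.
Variables (D E : subcategory C) (DE : sub_incl D E).

Lemma canonicalE (z : K0sp) : canonical DE (K0_proj E z) = K0_proj D z.
Proof.
by apply/K0_projP/(relative_relation_anti DE)/K0_projP; exact: reprK.
Qed.

Lemma canonical_class (A : C) : canonical DE (K0_class E A) = K0_class D A.
Proof. exact: canonicalE. Qed.

Lemma K0_proj_surj (F : subcategory C) (x : K0 F) : exists z, x = K0_proj F z.
Proof.
exists (repr (x : Quotient.quot (generated_pred (relative_relation F)))).
by symmetry; exact: reprK.
Qed.

Fact canonical_is_zmod_morphism : zmod_morphism (canonical DE).
Proof.
move=> x y; have [z ->] := K0_proj_surj x; have [w ->] := K0_proj_surj y.
by rewrite -raddfB !canonicalE raddfB.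
Qed.

HB.instance Definition _ :=
  GRing.isZmodMorphism.Build (K0 E) (K0 D) (canonical DE)
    canonical_is_zmod_morphism.

Lemma canonical_surj (y : K0 D) : exists x : K0 E, canonical DE x = y.
Proof.
by have [z ->] := K0_proj_surj y; exists (K0_proj E z); exact: canonicalE.
Qed.

End Canonical.

End Grothendieck.

Arguments K0_class {k C sk}.
Arguments canonical {k C} sk {D E}.

(* Main.v *)
From HB Require Import structures.
From mathcomp Require Import boolp.
From mathcomp Require Import all_boot all_order all_algebra zify ssrAC.
Require Import Defs.

Set Implicit Arguments.
Unset Strict Implicit.
Unset Printing Implicit Defensive.

Import GRing.Theory.
Local Open Scope ring_scope.

(** Attach to a triangle [A -> B -> E -> Sigma A] with connecting morphism [delta]
    the functor [M], the image of [C(-, delta)] on [T].  The class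
    [[A] - [B] + [E]] in the Grothendieck group relative to [T] depends on [M]
    only and is additive in it: it vanishes when [M] does, and if [delta h] is
    the restriction of [delta] along some [h : D -> E] then the class of [delta]
    is that of [delta h], the subfunctor of [M] generated by [h], plus that of
    the quotient ([defect_comp]).  The kernel of the canonical map is generated
    by the classes of those [delta] whose [M] vanishes on [X].

    Local boundedness gives such an [M] finite length: it is determined by its
    value, a finite-dimensional space, at one object ([finite_support]).  So [M]
    can be filtered with simple subquotients ([defect_generated]), and as [M]
    vanishes on [X] these sit at indecomposables of [Y].  A triangle whose
    functor is the simple one at [Y] has the same class as the first triangle of
    an Auslander-Reiten angle that ends in [Y] ([simple_defect]), while all
    further triangles of the angle have class zero ([ar_angle_sum]); so this
    class is the alternating sum of the angle.  Conversely the first triangle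
    belongs to the structure relative to [X], since morphisms from [X] to [Y] are
    not split epimorphisms ([ar_generator_kernel]).

    It remains that the angles exist ([ar_angle_exists]).  One starts with the
    minimal right almost split morphism onto [Y] and keeps taking minimal right
    [T]-approximations and fibers.  Shifting dimensions along these triangles
    shows that the object reached after [n] steps is in [T] and that the
    intermediate morphisms are left approximations.  For the last one being left
    almost split, consider the n-extension class of [Y] by the last object that
    the tower represents: it is killed by the radical of [Y], and by Serre
    duality it can be recovered from any of its non-zero push-outs
    ([tower_left_almost_split]). *)

(** * Dimension counting *)

Section Dimension.
Variables (k : fieldType).

Definition finite_dim (L : lmodType k) : Prop :=
  exists (d : nat) (b : 'I_d -> L), forall x, exists c, x = \sum_i c i *: b i.

Definition subspace (L : lmodType k) (K : L -> Prop) : Prop :=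
  K 0 /\ forall c x y, K x -> K y -> K (c *: x + y).

(** Dimensions occur only as measures that decrease, so lower bounds on them are
    enough and no bases of morphism spaces have to be chosen. *)
Definition has_indep (L : lmodType k) (K : L -> Prop) (d : nat) : Prop :=
  exists x : 'I_d -> L, (forall i, K (x i)) /\
    forall c, \sum_i c i *: x i = 0 -> forall i, c i = 0.

Lemma has_indep0 (L : lmodType k) (K : L -> Prop) : has_indep K 0.
Proof. by exists (fun=> 0); split=> [[]|c _ []]. Qed.

Lemma subspace_sum (L : lmodType k) (K : L -> Prop) d (c : 'I_d -> k)
    (x : 'I_d -> L) :
  subspace K -> (forall i, K (x i)) -> K (\sum_i c i *: x i).
Proof.
move=> [K0 KD] Kx; elim/big_ind: _ => // [u v Ku Kv|i _].
  by rewrite -[u]scale1r; apply: KD.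
by rewrite -[_ *: _]addr0; apply: KD.
Qed.

(** More vectors than a spanning family has are dependent, as the matrix of their
    coordinates has a kernel. *)
Lemma finite_dim_bound (L : lmodType k) :
  finite_dim L -> exists d, forall K : L -> Prop, ~ has_indep K d.
Proof.
move=> [d [b sp]]; exists d.+1 => K [x [_ indx]].
have [M Mx] := choice (fun i => sp (x i)).
pose A := \matrix_(i < d.+1, j < d) M i j.
have : kermx A != 0.
  by rewrite kermx_eq0 /row_free neq_ltn ltnS rank_leq_col.
case/rowV0Pn=> c /sub_kermxP cA /negP; apply; apply/eqP/rowP => i.
rewrite mxE; apply: (indx (fun i => c 0 i)).
transitivity (\sum_j (c *m A) 0 j *: b j); last first.
  by rewrite cA big1 // => j _; rewrite mxE scale0r.
under eq_bigr => i' _ do rewrite Mx scaler_sumr.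
rewrite exchange_big; apply: eq_bigr => j _ /=.
by rewrite mxE scaler_suml; apply: eq_bigr => i' _; rewrite mxE scalerA.
Qed.

(** Independent vectors of the image lift, and the lifts stay independent when a
    non-zero kernel element is added: the inequality of rank and nullity that
    makes dimensions drop along quotients. *)
Lemma has_indep_ker (L M : lmodType k) (f : L -> M) (K : L -> Prop)
    (K' : M -> Prop) (z : L) d :
  linear f -> (forall y, K' y -> exists2 x, K x & y = f x) ->
  K z -> f z = 0 -> z != 0 -> has_indep K' d -> has_indep K d.+1.
Proof.
move=> lf surj Kz fz z0 [y [K'y indy]].
have fD u v : f (u + v) = f u + f v.
  by have := lf 1 u v; rewrite !scale1r.
have f0 : f 0 = 0 by have := fD 0 0; rewrite addr0 -{1}[f 0]addr0 => /addrI <-.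
have fZ c u : f (c *: u) = c *: f u.
  by have := lf c u 0; rewrite addr0 f0 addr0.
have surj' i : exists u, K u /\ y i = f u.
  by have [u] := surj _ (K'y i); exists u.
have [x Kx] := choice surj'.
exists (fun i => oapp x z (unlift ord0 i)); split=> [i|c].
  by case: unliftP => [j _|_] //=; case: (Kx j).
rewrite big_ord_recl unlift_none /=.
under eq_bigr => i _ do rewrite liftK /=.
move=> e; have c0 : forall i, c (lift ord0 i) = 0.
  apply: (indy (fun i => c (lift ord0 i))).
  transitivity (f (c ord0 *: z + \sum_i c (lift ord0 i) *: x i)).
    rewrite fD fZ fz scaler0 add0r (big_morph f fD f0).
    by apply: eq_bigr => i _; rewrite fZ (Kx i).2.
  by rewrite e.
move=> i; case: (unliftP ord0 i) => [j ->|->] //.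
move/eqP: e; rewrite big1 ?addr0 ?scaler_eq0 ?(negPf z0) ?orbF => [/eqP //|j _].
by rewrite c0 scale0r.
Qed.

Lemma has_indep_proper (L : lmodType k) (K K' : L -> Prop) (y : L) d :
  subspace K' -> (forall x, K' x -> K x) -> K y -> ~ K' y ->
  has_indep K' d -> has_indep K d.+1.
Proof.
move=> sK' sub Ky nK'y [x [K'x indx]].
exists (fun i => oapp x y (unlift ord0 i)); split=> [i|c].
  by case: unliftP => [j _|_] //=; apply: sub.
rewrite big_ord_recl unlift_none /=.
under eq_bigr => i _ do rewrite liftK /=.
set s := \sum_i _; have K's c' : K' (c' *: s).
  by case: (sK') => K0 KD; rewrite -[_ *: _]addr0; apply: KD => //;
    apply: subspace_sum.
have [c0|c0] := eqVneq (c ord0) 0; last first.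
  move=> /eqP; rewrite addr_eq0 => /eqP e; case: nK'y.
  have -> : y = (- (c ord0)^-1) *: s.
    by rewrite scaleNr -scalerN -e scalerA mulVf ?scale1r.
  exact: K's.
rewrite c0 scale0r add0r => /(indx (fun i => c (lift ord0 i))) ci i.
by case: (unliftP ord0 i) => [j ->|->].
Qed.

Lemma descending_chain (L : lmodType k) (K : nat -> L -> Prop) :
  finite_dim L -> (forall m, subspace (K m)) ->
  (forall m x, K m.+1 x -> K m x) -> exists m, forall x, K m x -> K m.+1 x.
Proof.
move=> /finite_dim_bound [d nd] sK decr; apply: contrapT => ns.
suff: forall d m, has_indep (K m) d by move=> /(_ d 0%N); apply: nd.
elim=> [|d' IHd] m; first exact: has_indep0.
have [y Ky] : exists y, ~ (K m y -> K m.+1 y).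
  by apply: contrapT => h; apply: ns; exists m => x; apply: contrapT => ?;
    apply: h; exists x.
have [Kmy nKy] := (proj1 (not_implyP _ _) Ky).
exact: has_indep_proper (sK m.+1) (decr m) Kmy nKy (IHd m.+1).
Qed.

Lemma maximal_subspace (L : lmodType k) (I : Type) (K : I -> L -> Prop)
    (i0 : I) :
  finite_dim L -> (forall i, subspace (K i)) ->
  exists i, forall j, (forall x, K i x -> K j x) -> forall x, K j x -> K i x.
Proof.
move=> /finite_dim_bound [d nd] sK; apply: contrapT => ns.
suff: forall d, exists i, has_indep (K i) d by move=> /(_ d) [i]; apply: nd.
elim=> [|d' [i IHd]]; first by exists i0; apply: has_indep0.
have [j [sij [y [Kjy nKy]]]] : exists j, (forall x, K i x -> K j x) /\
    exists y, K j y /\ ~ K i y.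
  apply: contrapT => h; apply: ns; exists i => j sij x Kjx.
  by apply: contrapT => nKix; apply: h; exists j; split=> //; exists x.
by exists j; apply: has_indep_proper (sK i) sij Kjy nKy IHd.
Qed.

(** A subspace maximal among those that avoid [x] is a hyperplane, and the
    coordinate along [x] is the functional. *)
Lemma separating_functional (L : lmodType k) (V : L -> Prop) (x : L) :
  finite_dim L -> subspace V -> ~ V x ->
  exists phi : {scalar L}, (forall v, V v -> phi v = 0) /\ phi x != 0.
Proof.
move=> fL sV nVx.
pose I := {K : L -> Prop | subspace K /\ (forall v, V v -> K v) /\ ~ K x}.
have i0 : I by exists V.
have [[K [sK [VK nKx]]] maxK] := @maximal_subspace L I (fun i => sval i) i0 fL
  (fun i => (svalP i).1); case: (sK) => K0 KD.
have KB u v : K u -> K v -> K (u - v).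
  by move=> Ku Kv; rewrite addrC -scaleN1r; apply: KD.
have KZ c u : K u -> K (c *: u).
  by move=> Ku; rewrite -[_ *: _]addr0; apply: KD.
(* [K] is now shown to be a complement of the line through [x]: if [l] were not
   in [K + k x], then [K + k l] would be a larger subspace avoiding [x]. *)
have uniq c c' l : K (l - c *: x) -> K (l - c' *: x) -> c = c'.
  move=> Kc Kc'; apply/eqP; rewrite -subr_eq0; apply/negP => /negP n0.
  apply: (nKx); have -> : x = (c - c')^-1 *: ((c - c') *: x).
    by rewrite scalerA mulVf // scale1r.
  apply: KZ; have -> : (c - c') *: x = (l - c' *: x) - (l - c *: x).
    by rewrite opprB [RHS]addrC addrA subrK scalerBl.
  exact: KB.
have dec l : exists c, K (l - c *: x).
  apply: contrapT => nl.
  pose K' y := exists c, K (y - c *: l).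
  have sK' : subspace K'.
    split=> [|c y y' [a Ka] [b Kb]]; first by exists 0; rewrite scale0r subrr.
    exists (c * a + b); have := KD c _ _ Ka Kb.
    by rewrite scalerBr scalerDl !scalerA opprD addrACA.
  have nK'x : ~ K' x.
    move=> [c Kc]; have [c0|c0] := eqVneq c 0.
      by apply: (nKx); move: Kc; rewrite c0 scale0r subr0.
    apply: nl; exists c^-1; have := KZ (- c^-1) _ Kc.
    by rewrite scalerBr scalerA mulNr mulVf // scaleN1r opprK scaleNr addrC.
  have sub y : K y -> K' y by exists 0; rewrite scale0r subr0.
  have iK' : subspace K' /\ (forall v, V v -> K' v) /\ ~ K' x.
    by split=> //; split=> // v /VK; apply: sub.
  have Kl : K l.
    apply: (maxK (exist _ K' iK') sub); exists 1.
    by rewrite scale1r subrr.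
  by apply: nl; exists 0; rewrite scale0r subr0.
pose phi l := sval (cid (dec l)).
have phiP l : K (l - phi l *: x) by rewrite /phi; case: cid.
have lphi : linear (phi : L -> k^o).
  move=> c u v; apply: (uniq _ _ (c *: u + v)) => //.
  have := KD c _ _ (phiP u) (phiP v).
  by rewrite scalerBr addrACA -opprD scalerA -scalerDl.
pose lin := GRing.isLinear.Build k L k *%R phi lphi.
pose phi' : {scalar L} := HB.pack phi lin.
exists phi'; split=> [v Vv|] /=.
  by apply: (uniq _ _ v) => //; rewrite scale0r subr0; apply: (VK).
rewrite (_ : phi x = 1) ?oner_eq0 //.
by apply: (uniq _ _ x) => //; rewrite scale1r subrr.
Qed.

End Dimension.

(** * Linear categories *)

Section LinearCategories.
Variables (k : fieldType) (C : lincat k).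
Implicit Types A B D E Z : C.

Lemma compDl A B D (f g : hom B D) (h : hom A B) :
  (f + g) \co h = f \co h + g \co h.
Proof. by have := comp_linearl h 1 f g; rewrite !scale1r. Qed.

Lemma compDr A B D (h : hom B D) (f g : hom A B) :
  h \co (f + g) = h \co f + h \co g.
Proof. by have := comp_linearr h 1 f g; rewrite !scale1r. Qed.

Lemma comp0l A B D (h : hom A B) : (0 : hom B D) \co h = 0.
Proof. by apply: (addrI (0 \co h)); rewrite -compDl !addr0. Qed.

Lemma comp0r A B D (h : hom B D) : h \co (0 : hom A B) = 0.
Proof. by apply: (addrI (h \co 0)); rewrite -compDr !addr0. Qed.

Lemma compNl A B D (f : hom B D) (h : hom A B) : (- f) \co h = - (f \co h).
Proof. by apply: (addrI (f \co h)); rewrite -compDl !subrr comp0l. Qed.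

Lemma compNr A B D (h : hom B D) (f : hom A B) : h \co (- f) = - (h \co f).
Proof. by apply: (addrI (h \co f)); rewrite -compDr !subrr comp0r. Qed.

Lemma compBl A B D (f g : hom B D) (h : hom A B) :
  (f - g) \co h = f \co h - g \co h.
Proof. by rewrite compDl compNl. Qed.

Lemma compBr A B D (h : hom B D) (f g : hom A B) :
  h \co (f - g) = h \co f - h \co g.
Proof. by rewrite compDr compNr. Qed.

Lemma image_subspace A B D (g : hom B D) :
  subspace (fun y => exists x : hom A B, y = g \co x).
Proof.
split=> [|c _ _ [x ->] [y ->]]; first by exists 0; rewrite comp0r.
by exists (c *: x + y); rewrite (comp_linearr g).
Qed.

Lemma coimage_subspace A B D (g : hom A B) :
  subspace (fun y => exists x : hom B D, y = x \co g).
Proof.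
split=> [|c _ _ [x ->] [y ->]]; first by exists 0; rewrite comp0l.
by exists (c *: x + y); rewrite (comp_linearl g).
Qed.

Lemma idm_iso A : is_iso (idm A).
Proof. by exists (idm A); rewrite comp_idl. Qed.

Lemma is_iso_inv A B (f : hom A B) : is_iso f ->
  exists g : hom B A, [/\ g \co f = idm A, f \co g = idm B & is_iso g].
Proof. by move=> [g [gf fg]]; exists g; split=> //; exists f. Qed.

Lemma is_isoP A B (f : hom A B) (g h : hom B A) :
  g \co f = idm A -> f \co h = idm B -> is_iso f.
Proof.
move=> gf fh; exists g; split=> //.
by rewrite -[g]comp_idr -fh (comp_assoc g) gf comp_idl fh.
Qed.

Lemma zero_source Z A (f : hom Z A) : is_zero Z -> f = 0.
Proof. by rewrite -[f]comp_idr => ->; rewrite comp0r. Qed.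

Lemma zero_target A Z (f : hom A Z) : is_zero Z -> f = 0.
Proof. by rewrite -[f]comp_idl => ->; rewrite comp0l. Qed.

(** The inverse is the formal geometric series
    [1 + f g + f (g f) g + ...  =  1 + f (1 - g f)^-1 g]. *)
Lemma is_iso1B_swap A B (f : hom A B) (g : hom B A) :
  is_iso (idm A - g \co f) -> is_iso (idm B - f \co g).
Proof.
move=> [h [h1 h2]]; exists (idm B + f \co h \co g).
have e1 : h \co (g \co f) = h - idm A.
  by rewrite -[in RHS]h1 compBr comp_idr opprB addrC subrK.
have e2 : g \co f \co h = h - idm A.
  by rewrite -[in RHS]h2 compBl comp_idl opprB addrC subrK.
have e3 : f \co h \co g \co (f \co g) = f \co h \co g - f \co g.
  transitivity (f \co (h \co (g \co f)) \co g); first by rewrite !comp_assoc.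
  by rewrite e1 compBr comp_idr compBl.
have e4 : f \co g \co (f \co h \co g) = f \co h \co g - f \co g.
  transitivity (f \co (g \co f \co h) \co g); first by rewrite !comp_assoc.
  by rewrite e2 compBr comp_idr compBl.
split.
  by rewrite compBr comp_idr compDl comp_idl e3 [f \co g + _]addrC subrK addrK.
by rewrite compDr comp_idr compBl comp_idl e4 subKr subrK.
Qed.

(** ** Retracts and biproducts *)

Definition retract Z A : Prop :=
  exists (s : hom Z A) (r : hom A Z), r \co s = idm Z.

Lemma retract_trans A B D : retract A B -> retract B D -> retract A D.
Proof.
move=> [s [r rs]] [s' [r' rs']]; exists (s' \co s), (r \co r').
by rewrite comp_assoc -(comp_assoc r) rs' comp_idr.
Qed.

Lemma iso_retract A B : isomorphic A B -> retract A B.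
Proof. by move=> [f [g [gf fg]]]; exists f, g. Qed.

Lemma biproduct_retract A B D : is_biproduct A B D -> retract A D /\ retract B D.
Proof.
by move=> [i1 [i2 [p1 [p2 [e1 e2 _ _ _]]]]]; split; [exists i1, p1|exists i2, p2].
Qed.

Lemma biproduct_sym A B D : is_biproduct A B D -> is_biproduct B A D.
Proof.
move=> [i1 [i2 [p1 [p2 [e1 e2 e3 e4 e5]]]]]; exists i2, i1, p2, p1.
by split; rewrite // addrC.
Qed.

Lemma indecomposable_iso A B :
  isomorphic A B -> indecomposable A -> indecomposable B.
Proof.
move=> [g [g' [g'g gg']]] [nA indA]; split=> [B0|A1 A2 [i1 [i2 [p1 [p2 []]]]]].
  by apply: nA; rewrite /is_zero -g'g (zero_source g' B0) comp0l.
move=> e1 e2 e3 e4 e5.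
apply: indA; exists (g' \co i1), (g' \co i2), (p1 \co g), (p2 \co g).
have c X X' (p : hom B X) (j : hom X' B) : p \co g \co (g' \co j) = p \co j.
  by rewrite comp_assoc -(comp_assoc p) gg' comp_idr.
rewrite !c; split=> //.
by rewrite !comp_assoc -compDl -!(comp_assoc g') -compDr e5 comp_idr.
Qed.

Hypothesis split_idem : idempotent_complete C.

Lemma split_retract Z A (s : hom Z A) (r : hom A Z) : r \co s = idm Z ->
  exists (Z' : C) (s' : hom Z' A) (r' : hom A Z'),
    [/\ r' \co s' = idm Z', r \co s' = 0, r' \co s = 0
      & s \co r + s' \co r' = idm A].
Proof.
move=> rs; pose e := idm A - s \co r.
have es : e \co s = 0 by rewrite compBl comp_idl -comp_assoc rs comp_idr subrr.
have re : r \co e = 0 by rewrite compBr comp_idr comp_assoc rs comp_idl subrr.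
have ee : e \co e = e by rewrite {1}/e compBl comp_idl -comp_assoc re comp0r subr0.
have [Z' [r' [s' [sr' rs']]]] := split_idem ee.
exists Z', s', r'; split=> //.
- by rewrite -[s']comp_idr -rs' (comp_assoc s') sr' comp_assoc re comp0l.
- by rewrite -[r']comp_idl -rs' -(comp_assoc r') sr' -comp_assoc es comp0r.
- by rewrite sr' addrC subrK.
Qed.

Lemma retract_biproduct Z A : retract Z A -> exists Z', is_biproduct Z Z' A.
Proof.
move=> [s [r rs]]; have [Z' [s' [r' [e1 e2 e3 e4]]]] := split_retract rs.
by exists Z', s, s', r, r'.
Qed.

Lemma retract_sub (T : subcategory C) Z A :
  additive_subcategory T -> retract Z A -> T A -> T Z.
Proof.
move=> [_ _ _ Ts] /retract_biproduct [Z' bp] TA.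
by have [] := Ts _ _ _ bp TA.
Qed.

Lemma retract_indec Z A (s : hom Z A) (r : hom A Z) :
  indecomposable A -> r \co s = idm Z -> ~ is_zero Z -> s \co r = idm A.
Proof.
move=> [_ indA] rs nZ; have [Z' [s' [r' [e1 e2 e3 e4]]]] := split_retract rs.
have [//|Z'0] : is_zero Z \/ is_zero Z' by apply: (indA Z Z'); exists s, s', r, r'.
by rewrite -e4 (zero_source s' Z'0) comp0l addr0.
Qed.

End LinearCategories.

(** ** Fitting's lemma *)

Section EndomorphismRing.
Variables (k : fieldType) (C : lincat k) (A : C).

Definition endo : Type := hom A A.

HB.instance Definition _ := GRing.Zmodule.copy endo (hom A A).
HB.instance Definition _ := GRing.Zmodule_isPzRing.Build endo
  (@comp_assoc k C A A A A) (@comp_idl k C A A) (@comp_idr k C A A)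
  (fun f g h => @compDl k C A A A f g h) (fun h f g => @compDr k C A A A h f g).

End EndomorphismRing.

(** With [b] for the power of [a], the equations [b = b b h = w b b] make
    [b h = w b] an idempotent, on whose image [b] is invertible and on whose
    complement it vanishes. *)
Lemma strongly_pi_regular (R : pzRingType) (a u v : R) (m m' : nat) :
  a ^+ m = a ^+ m.+1 * u -> a ^+ m' = v * a ^+ m'.+1 ->
  exists (n : nat) (h w : R),
    a ^+ n.+1 = a ^+ n.+1 * a ^+ n.+1 * h /\
    a ^+ n.+1 = w * (a ^+ n.+1 * a ^+ n.+1).
Proof.
move=> au av; pose n := (m + m')%N; exists n, (u ^+ n.+1), (v ^+ n.+1).
(* [n] exceeds both stabilisation indices, so one factor [a u] can be traded
   in at a time *)
have ru j : a ^+ n.+1 = a ^+ (n.+1 + j) * u ^+ j.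
  elim: j => [|j IHj]; first by rewrite addn0 mulr1.
  rewrite {1}IHj (_ : (n.+1 + j = (m' + j).+1 + m)%N); last first.
    by rewrite /n; lia.
  rewrite exprD au mulrA -exprD -mulrA -exprS; congr (a ^+ _ * _).
  by rewrite /n; lia.
have lv j : a ^+ n.+1 = v ^+ j * a ^+ (n.+1 + j).
  elim: j => [|j IHj]; first by rewrite addn0 mul1r.
  rewrite {1}IHj (_ : (n.+1 + j = m' + (m + j).+1)%N); last first.
    by rewrite /n; lia.
  rewrite exprD av -mulrA -exprD mulrA -exprSr; congr (_ * a ^+ _).
  by rewrite /n; lia.
by rewrite -exprD; split; [apply: ru|apply: lv].
Qed.

Lemma is_iso1B_nilpotent (R : pzRingType) (a : R) n : a ^+ n = 0 ->
  exists b, b * (1 - a) = 1 /\ (1 - a) * b = 1.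
Proof.
move=> an; exists (\sum_(i < n) a ^+ i).
have e := subrX1 a n; rewrite an sub0r in e.
have -> : (1 - a) * \sum_(i < n) a ^+ i = 1.
  by rewrite -opprB mulNr -e opprK.
split=> //; have c : GRing.comm (1 - a) (\sum_(i < n) a ^+ i).
  apply: commr_sum => i _; apply: commrX; apply/commr_sym/commrB => //.
  exact: commr1.
by rewrite -c -opprB mulNr -e opprK.
Qed.

Section Fitting.
Variables (k : fieldType) (C : lincat k).
Implicit Types A B D E Z : C.

(** The idempotent [e] is the one by which a power [b] of [a] is regular, namely
    [e = b h] with [b = b b h]: a morphism that [a] fixes on the right is fixed
    by [b] and [h], hence by [e], and [e = 0] makes [a] nilpotent. *)
Lemma fitting A (a : hom A A) : finite_dim (hom A A) ->
  exists e x y : hom A A,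
    [/\ e \co e = e, e = a \co x, e = y \co a,
        forall B (f : hom A B), f \co a = f -> f \co e = f
      & e = 0 -> is_iso (idm A - a)].
Proof.
move=> fA; pose a' : endo A := a.
have [m Km] : exists m, forall x : hom A A,
    (exists y : endo A, x = a' ^+ m * y) ->
    exists y : endo A, x = a' ^+ m.+1 * y.
  apply: (@descending_chain k (hom A A)
    (fun m x => exists y : endo A, x = a' ^+ m * y) fA) => m.
    exact: image_subspace.
  by move=> x [y ->]; exists (a' * y); rewrite mulrA -exprSr.
have [m' Km'] : exists m, forall x : hom A A,
    (exists y : endo A, x = y * a' ^+ m) ->
    exists y : endo A, x = y * a' ^+ m.+1.
  apply: (@descending_chain k (hom A A)
    (fun m x => exists y : endo A, x = y * a' ^+ m) fA) => m'.
    exact: coimage_subspace.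
  by move=> x [y ->]; exists (y * a'); rewrite -mulrA -exprS.
have [u au] := Km _ (ex_intro _ 1 (esym (mulr1 (a' ^+ m)))).
have [v av] := Km' _ (ex_intro _ 1 (esym (mul1r (a' ^+ m')))).
have [n [h [w [bh wb]]]] := @strongly_pi_regular (endo A) a' u v m m' au av.
set b := a' ^+ n.+1 in bh wb.
have ewb : b * h = w * b by rewrite {1}wb -!mulrA (mulrA b b h) -bh.
exists (b * h), (a' ^+ n * h), (w * a' ^+ n); split.
- change (b * h * (b * h) = b * h).
  by rewrite {1}ewb mulrA -(mulrA w b b) -wb.
- by change (b * h = a' * (a' ^+ n * h)); rewrite mulrA -exprS.
- by change (b * h = w * a' ^+ n * a'); rewrite ewb -mulrA -exprSr.
- move=> B f fa.
  have fX j : f \co (a' ^+ j : hom A A) = f.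
    elim: j => [|j IHj]; first exact: comp_idr.
    rewrite exprS; change (f \co (a \co (a' ^+ j : hom A A)) = f).
    by rewrite comp_assoc fa.
  have fh : f \co h = f.
    rewrite -{2}(fX n.+1) -/b bh -exprD.
    change (f \co h = f \co ((a' ^+ (n.+1 + n.+1) : hom A A) \co h)).
    by rewrite comp_assoc fX.
  change (f \co ((b : hom A A) \co h) = f).
  by rewrite comp_assoc /b fX.
- move=> e0; have b0 : b = 0 by rewrite bh -mulrA e0 mulr0.
  have [c [c1 c2]] := @is_iso1B_nilpotent (endo A) a' _ b0.
  by exists c; split.
Qed.

End Fitting.

(** * Krull-Schmidt categories *)

Section KrullSchmidt.
Variables (k : fieldType) (C : lincat k).
Implicit Types A B D E Z : C.

Hypothesis hom_fin : hom_finite C.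
Hypothesis split_idem : idempotent_complete C.

Lemma finite_dim_hom A B : finite_dim (hom A B).
Proof. exact: hom_fin. Qed.

Definition whole (L : lmodType k) (_ : L) : Prop := True.
Arguments whole : clear implicits.

(** Compression by a retraction maps [End A] onto [End Z] and kills [1 - s r], so
    the endomorphism algebra of a proper summand is strictly smaller. *)
Lemma retract_indep A Z (s : hom Z A) (r : hom A Z) d :
  r \co s = idm Z -> s \co r <> idm A ->
  has_indep (whole (hom Z Z)) d -> has_indep (whole (hom A A)) d.+1.
Proof.
move=> rs /eqP sr; apply: (@has_indep_ker k _ _
  (fun x : hom A A => r \co x \co s) _ _ (idm A - s \co r)) => //.
- by move=> c x y /=; rewrite (comp_linearr r) (comp_linearl s).
- move=> y _; exists (s \co y \co r) => //.
  by rewrite -2!(comp_assoc _ _ s) rs comp_idr comp_assoc rs comp_idl.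
- by rewrite compBr comp_idr comp_assoc rs comp_idl subrr comp0l.
- by rewrite subr_eq0 eq_sym.
Qed.

(** The endomorphism algebra of an indecomposable object is local: the Fitting
    idempotent is [0] or [1]. *)
Lemma indec_end A (a : hom A A) : indecomposable A ->
  is_iso a \/ is_iso (idm A - a).
Proof.
move=> indA; have [e [x [y [ee ax ya _ e0]]]] := fitting a (finite_dim_hom A A).
have [Z [r [s [sr rs]]]] := split_idem ee.
have [Z0|nZ] := pselect (is_zero Z).
  by right; apply: e0; rewrite -sr (zero_source s Z0) comp0l.
left; apply: (@is_isoP _ _ _ _ a y x).
  by rewrite -ya -sr (retract_indec split_idem indA rs nZ).
by rewrite -ax -sr (retract_indec split_idem indA rs nZ).
Qed.

(** Every object is a finite direct sum of indecomposables, because splitting off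
    a summand lowers the dimension of the endomorphism algebra. *)
Lemma object_induction (P : C -> Prop) :
  (forall Z, is_zero Z -> P Z) -> (forall A, indecomposable A -> P A) ->
  (forall A B D, is_biproduct A B D -> P A -> P B -> P D) -> forall A, P A.
Proof.
move=> P0 Pi PD A; have [d /(_ (whole _)) nd] := finite_dim_bound (finite_dim_hom A A).
elim: d A nd => [|d IHd] A nd; first by case: nd; apply: has_indep0.
have [/P0 //|nA] := pselect (is_zero A).
have [/Pi //|nI] := pselect (indecomposable A).
have [A1 [A2 [bp [n1 n2]]]] : exists A1 A2, is_biproduct A1 A2 A /\
    (~ is_zero A1 /\ ~ is_zero A2).
  apply: contrapT => h; apply: nI; split=> // A1 A2 bp; apply: contrapT.
  by move=> /not_orP n; apply: h; exists A1, A2.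
have smaller B1 B2 : is_biproduct B1 B2 A -> ~ is_zero B2 -> P B1.
  move=> [i1 [i2 [p1 [p2 [e1 e2 e3 e4 e5]]]]] nB2; apply: IHd.
  move=> h; apply: nd; apply: (retract_indep e1) h => e; apply: nB2.
  rewrite /is_zero -e2 -[i2]comp_idl -e [X in _ \co X](_ : _ = 0) ?comp0r //.
  by rewrite -comp_assoc e3 comp0r.
exact: PD bp (smaller _ _ bp n2) (smaller _ _ (biproduct_sym bp) n1).
Qed.

(** If [f g = f] with [g] not invertible, the Fitting idempotent [e] of [g] is
    proper and still satisfies [f e = f], so [f] may be restricted to the image
    of [e], which is a smaller object. *)
Lemma right_minimal_part A B (f : hom A B) :
  exists (Z : C) (s : hom Z A) (r : hom A Z),
    [/\ r \co s = idm Z, f \co s \co r = f & right_minimal (f \co s)].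
Proof.
have [d /(_ (whole _)) nd] := finite_dim_bound (finite_dim_hom A A).
elim: d A f nd => [|d IHd] A f nd; first by case: nd; apply: has_indep0.
have [mf|nm] := pselect (right_minimal f).
  by exists A, (idm A), (idm A); rewrite !comp_idr.
have [g [fg ng]] : exists g, f \co g = f /\ ~ is_iso g.
  by apply: contrapT => h; apply: nm => g fg; apply: contrapT => ng; apply: h; exists g.
have [e [x [y [ee ex ey fe _]]]] := fitting g (finite_dim_hom A A).
have [Z [r [s [sr rs]]]] := split_idem ee.
have [|Z' [s' [r' [rs' fsr' mfs]]]] := IHd Z (f \co s).
  move=> h; apply: nd; apply: (retract_indep rs) h; rewrite sr => e1.
  by apply: ng; apply: (@is_isoP _ _ _ _ g y x); rewrite -?ex -?ey.
exists Z', (s \co s'), (r' \co r); rewrite !comp_assoc; split=> //.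
  by rewrite -(comp_assoc r') rs comp_idr.
by rewrite fsr' -comp_assoc sr; apply: fe.
Qed.

Lemma minimal_right_approximation (T : subcategory C) A :
  additive_subcategory T -> contravariantly_finite T ->
  exists A' (f : hom A' A), right_approximation T f /\ right_minimal f.
Proof.
move=> addT /(_ A) [A' [f [TA' appf]]].
have [Z [s [r [rs fsr mfs]]]] := right_minimal_part f.
exists Z, (f \co s); split=> //; split.
  by apply: retract_sub TA' => //; exists s, r.
move=> B h /appf - /(_ h) [g ->]; exists (r \co g).
by rewrite comp_assoc fsr.
Qed.

(** The idempotent of a summand killed by [f] can be subtracted from the identity
    without changing [f]. *)
Lemma right_minimal_kernel A B Z (f : hom A B) (s : hom Z A) (r : hom A Z) :
  right_minimal f -> r \co s = idm Z -> f \co s = 0 -> is_zero Z.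
Proof.
move=> mf rs fs; have [|h [h1 h2]] := mf (idm A - s \co r).
  by rewrite compBr comp_idr comp_assoc fs comp0l subr0.
have s0 : (idm A - s \co r) \co s = 0.
  by rewrite compBl comp_idl -comp_assoc rs comp_idr subrr.
by rewrite /is_zero -rs -[s]comp_idl -h1 -(comp_assoc h) s0 !comp0r.
Qed.

(** If the Fitting idempotent of [z b] is non-zero then its image is a non-zero
    summand of [A] that [b] embeds as a summand into [B]. *)
Lemma radical_is_iso1B A B (z : hom B A) (b : hom A B) :
  (forall Z (p : hom B Z) (s : hom Z A), p \co b \co s = idm Z ->
     (exists r : hom A Z, r \co s = idm Z) -> is_zero Z) ->
  is_iso (idm A - z \co b).
Proof.
move=> rad; have [e [x [y [ee ex ey _ e0]]]] :=
  fitting (z \co b) (finite_dim_hom A A).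
have [Z [r [s [sr rs]]]] := split_idem ee; apply: e0; rewrite -sr.
suff Z0 : is_zero Z by rewrite (zero_source s Z0) comp0l.
have res : r \co e \co s = idm Z by rewrite -sr comp_assoc rs comp_idl.
apply: (rad Z (r \co y \co z) s).
  by rewrite -!comp_assoc (comp_assoc z) (comp_assoc y) -ey comp_assoc.
by exists r.
Qed.

End KrullSchmidt.

(** * Finite support and almost split morphisms *)

Section AlmostSplit.
Variables (k : fieldType) (C : tricat k) (sk : skeleton C) (T : subcategory C).
Implicit Types A B D E Z : C.

Hypothesis hom_fin : hom_finite C.
Hypothesis split_idem : idempotent_complete C.
Hypothesis addT : additive_subcategory T.
Hypothesis boundT : locally_bounded sk T.

Lemma additive_sum (s : seq sk) : exists G, T G /\
  forall i, i \in s -> T (sk_obj i) -> retract (sk_obj i) G.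
Proof.
case: (addT) => Tiso T0 Tsum _.
elim: s => [|i s [G [TG sG]]].
  by have [Z Z0] := zero_exists C; exists Z; split; [apply: T0|].
have [Ti|nTi] := pselect (T (sk_obj i)); last first.
  by exists G; split=> // j; rewrite inE => /orP[/eqP->|/sG].
have [G' bp] := biproduct_exists (sk_obj i) G; exists G'.
have [ri rG] := biproduct_retract bp; split; first exact: Tsum bp Ti TG.
move=> j; rewrite inE => /orP[/eqP-> //|js Tj].
exact: retract_trans (sG j js Tj) rG.
Qed.

(** Local boundedness bundles the finitely many indecomposables that map to [E]
    into one test object. *)
Lemma finite_support E : T E -> exists G, T G /\
  forall A, T A -> indecomposable A -> (exists f : hom A E, f <> 0) ->
    retract A G.
Proof.
move=> TE; case: (addT) => Tiso T0 Tsum Tsummand.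
suff [s sE] : exists s : seq sk, forall i, indec T i ->
    (exists f : hom (sk_obj i) E, f <> 0) -> i \in s.
  have [G [TG sG]] := additive_sum s; exists G; split=> // A TA indA [f f0].
  have [i [g [g' [g'g gg']]]] := sk_surj sk A.
  have isoAi : isomorphic A (sk_obj i) by exists g, g'.
  have Ti : T (sk_obj i) by apply: Tiso TA.
  apply: retract_trans (iso_retract isoAi) (sG i _ Ti); apply: sE.
    by split=> //; apply: indecomposable_iso indA.
  exists (f \co g') => fg; apply: f0.
  by rewrite -[f]comp_idr -g'g comp_assoc fg comp0l.
elim/(object_induction hom_fin): E TE => [Z Z0 _|A indA TA|].
- by exists [::] => i _ [f []]; apply: zero_target.
- have [s sA] := boundT.2 A TA indA; exists s => i Ti [f /eqP f0].
  by apply: sA => //; right; exists f.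
- move=> A B D bp IA IB TD; have [TA TB] := Tsummand _ _ _ bp TD.
  have [s sA] := IA TA; have [s' sB] := IB TB; exists (s ++ s') => i Ti [f f0].
  rewrite mem_cat; case: bp => i1 [i2 [p1 [p2 [e1 e2 e3 e4 e5]]]].
  have [p1f|p1f] := pselect (p1 \co f = 0); last first.
    by rewrite sA //; exists (p1 \co f).
  rewrite orbC sB //; exists (p2 \co f) => p2f; apply: f0.
  by rewrite -[f]comp_idl -e5 compDl -!comp_assoc p1f p2f !comp0r addr0.
Qed.

Lemma not_split_epiD A B D E (f : hom A E) (g : hom B E)
    (p : hom D A) (q : hom D B) : indecomposable E ->
  ~ split_epi f -> ~ split_epi g -> ~ split_epi (f \co p + g \co q).
Proof.
move=> indE nf ng [s]; rewrite compDl -!comp_assoc => e.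
have [[h [_ h2]]|] := indec_end hom_fin split_idem (f \co (p \co s)) indE.
  by apply: nf; exists (p \co s \co h); rewrite comp_assoc.
rewrite -e addrC addKr => -[h [_ h2]].
by apply: ng; exists (q \co s \co h); rewrite comp_assoc.
Qed.

(** Only the finitely many indecomposables of [T] that map to [E] matter, and
    these are summands of one object [G].  Choose [f] among the morphisms that
    are not split epimorphisms such that its image under [C(G, -)] is maximal.
    Sums of morphisms that are not split epimorphisms are of the same kind, as
    [End E] is local, so [f] can be enlarged by any such [G -> E] and hence has
    all of them in its image. *)
Lemma minimal_right_almost_split E : T E -> indecomposable E ->
  exists A (f : hom A E), right_almost_split T f /\ right_minimal f.
Proof.
move=> TE indE; case: (addT) => Tiso T0 Tsum Tsummand.
have [G [TG sG]] := finite_support TE.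
pose I := {W : C & {f : hom W E | T W /\ ~ split_epi f}}.
pose K (i : I) (y : hom G E) := exists x, y = sval (projT2 i) \co x.
have [Z Z0] := zero_exists C.
have nsp0 A : ~ split_epi (0 : hom A E).
  by move=> [s]; rewrite comp0l => e; case: indE => nE _; apply: nE.
pose i0 : I := existT _ Z (exist _ 0 (conj (T0 _ Z0) (nsp0 Z))).
have [[W [f [TW nf]]] /= maxf] := maximal_subspace i0 (finite_dim_hom hom_fin G E)
  (fun i => image_subspace _ (sval (projT2 i))) : exists i, forall j,
    (forall y, K i y -> K j y) -> forall y, K j y -> K i y.
have Gf (b : hom G E) : ~ split_epi b -> exists x, b = f \co x.
  move=> nb; have [D bp] := biproduct_exists W G.
  have TD := Tsum _ _ _ bp TW TG.
  case: bp => i1 [i2 [p1 [p2 [e1 e2 e3 e4 e5]]]].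
  have nD := not_split_epiD (p := p1) (q := p2) indE nf nb.
  apply: (maxf (existT _ D (exist _ _ (conj TD nD)))) => [_ [x ->]|] /=.
    exists (i1 \co x); rewrite compDl -!comp_assoc !(comp_assoc _ i1) e1 e4.
    by rewrite comp_idl comp0l comp0r addr0.
  exists i2; rewrite compDl -!comp_assoc e3 e2.
  by rewrite comp_idr comp0r add0r.
have Tf : forall A, T A -> forall h : hom A E, ~ split_epi h ->
    exists x, h = f \co x.
  move=> A0; elim/(object_induction hom_fin): A0 =>
      [A A0 _ h _|A indA TA h nh|].
  - by exists 0; rewrite comp0r; apply: zero_source.
  - have [->|h0] := pselect (h = 0); first by exists 0; rewrite comp0r.
    have [s [r rs]] := sG A TA indA (ex_intro _ h h0).
    have [|x hx] := Gf (h \co r).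
      by move=> [t ht]; apply: nh; exists (r \co t); rewrite comp_assoc.
    by exists (x \co s); rewrite comp_assoc -hx -comp_assoc rs comp_idr.
  - move=> A B D bp IA IB TD h nh; have [TA TB] := Tsummand _ _ _ bp TD.
    case: bp => i1 [i2 [p1 [p2 [_ _ _ _ e5]]]].
    have nhi B' (j : hom B' D) : ~ split_epi (h \co j).
      by move=> [t ht]; apply: nh; exists (j \co t); rewrite comp_assoc.
    have [x hx] := IA TA _ (nhi _ i1); have [y hy] := IB TB _ (nhi _ i2).
    exists (x \co p1 + y \co p2).
    by rewrite compDr !comp_assoc -hx -hy -!comp_assoc -compDr e5 comp_idr.
have [W' [s [r [rs fsr mfs]]]] := right_minimal_part hom_fin split_idem f.
exists W', (f \co s); split=> //; split=> //.
- by apply: (retract_sub split_idem addT _ TW); exists s, r.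
- by move=> [t ft]; apply: (nf); exists (s \co t); rewrite comp_assoc.
- move=> A h TA nh; have [x ->] := Tf A TA h nh.
  by exists (r \co x); rewrite comp_assoc fsr.
Qed.

End AlmostSplit.

(** * Triangulated categories *)

Section Functors.
Variables (k : fieldType) (C : lincat k) (F : linfunctor C).
Implicit Types A B D : C.

Lemma fmapD A B (f g : hom A B) : fmap F (f + g) = fmap F f + fmap F g.
Proof. by have := fmap_linear F 1 f g; rewrite !scale1r. Qed.

Lemma fmap0 A B : fmap F (0 : hom A B) = 0.
Proof. by apply: (addrI (fmap F 0)); rewrite -fmapD !addr0. Qed.

Lemma fmapN A B (f : hom A B) : fmap F (- f) = - fmap F f.
Proof. by apply: (addrI (fmap F f)); rewrite -fmapD !subrr fmap0. Qed.

Lemma fmapB A B (f g : hom A B) : fmap F (f - g) = fmap F f - fmap F g.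
Proof. by rewrite fmapD fmapN. Qed.

Hypothesis equivF : is_equivalence F.

Lemma equivalence_faithful A B (f g : hom A B) : fmap F f = fmap F g -> f = g.
Proof.
case: equivF => G [u [v [ui vi un vn]]] e.
have [u' [_ uu']] := ui A.
by rewrite -[f]comp_idr -[g]comp_idr -uu' !comp_assoc !un e.
Qed.

(** The preimage of [h] is [G h] conjugated by the natural isomorphism; that
    [F] maps it to [h] is checked after applying [G], which is faithful too. *)
Lemma equivalence_full A B (h : hom (F A) (F B)) : exists f, fmap F f = h.
Proof.
case: equivF => G [u [v [ui vi un vn]]].
have [u' [u'u uu']] := ui A; have [w [wu uw]] := ui B.
exists (u B \co fmap G h \co u').
have Gfaith (f : hom (F A) (F B)) (g : hom (F A) (F B)) :
    fmap G f = fmap G g -> f = g.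
  move=> e; have [v' [_ vv']] := vi (F A).
  by rewrite -[f]comp_idr -[g]comp_idr -vv' !comp_assoc !vn e.
apply: Gfaith; have := un _ _ (u B \co fmap G h \co u').
rewrite -comp_assoc u'u comp_idr => /(congr1 (fun x => w \co x)).
by rewrite !comp_assoc wu !comp_idl => <-.
Qed.

Lemma equivalence_surj B : exists A (f : hom (F A) B), is_iso f.
Proof. by case: equivF => G [u [v [ui vi un vn]]]; exists (G B), (v B). Qed.

Lemma fmap_zero A : is_zero A -> is_zero (F A).
Proof. by rewrite /is_zero -fmap_id => ->; rewrite fmap0. Qed.

Lemma equivalence_reflects_biproduct A B D :
  is_biproduct (F A) (F B) (F D) -> is_biproduct A B D.
Proof.
move=> [i1 [i2 [p1 [p2 []]]]].
have [j1 <-] := equivalence_full i1; have [j2 <-] := equivalence_full i2.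
have [q1 <-] := equivalence_full p1; have [q2 <-] := equivalence_full p2.
rewrite -!fmap_comp -fmapD => e1 e2 e3 e4 e5; exists j1, j2, q1, q2.
by split; apply: equivalence_faithful; rewrite ?fmap_id ?fmap0.
Qed.

End Functors.

Section Triangles.
Variables (k : fieldType) (C : tricat k).
Implicit Types A B D E W Z : C.
Notation S := (susp C).
Let equivS := susp_equivalence C.

Lemma susp_inj A B (f g : hom A B) : fmap S f = fmap S g -> f = g.
Proof. exact: equivalence_faithful. Qed.

Section Exactness.
Variables (A B D : C) (f : hom A B) (g : hom B D) (h : hom D (S A)).
Hypothesis tr : triangle f g h.

Lemma triangle_comp12 : g \co f = 0.
Proof.
have [Z Z0] := zero_exists C.
have [|c [e _]] := triangle_fill (a := idm A) (b := f) (triangle_id A Z0) tr.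
  by [].
by rewrite -e comp0r.
Qed.

(** [x] extends to a morphism from the triangle [W -> 0 -> Sigma W] to the
    rotated triangle, and the third component, desuspended, is the lift. *)
Lemma triangle_exact_mid W (x : hom W B) :
  g \co x = 0 -> exists y, x = f \co y.
Proof.
move=> gx; have [Z Z0] := zero_exists C.
have trW := (triangle_rotate _ _ _).1 (triangle_id W Z0).
have trB := (triangle_rotate _ _ _).1 tr.
have [|c [_ e]] := triangle_fill (a := x) (b := 0) trW trB.
  by rewrite comp0l gx.
have [y ye] := equivalence_full equivS c.
exists y; apply: susp_inj; rewrite fmap_comp ye.
by apply: oppr_inj; rewrite -compNl -e compNr fmap_id comp_idr.
Qed.

End Exactness.

Section ExactnessRotated.
Variables (A B D : C) (f : hom A B) (g : hom B D) (h : hom D (S A)).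
Hypothesis tr : triangle f g h.
Let tr1 : triangle g h (- fmap S f) := (triangle_rotate f g h).1 tr.
Let tr2 : triangle h (- fmap S f) (- fmap S g) := (triangle_rotate _ _ _).1 tr1.

Lemma triangle_comp23 : h \co g = 0.
Proof. exact: triangle_comp12 tr1. Qed.

Lemma triangle_comp31 : fmap S f \co h = 0.
Proof. by apply: oppr_inj; rewrite -compNl (triangle_comp12 tr2) oppr0. Qed.

Lemma triangle_exact_right W (x : hom W D) :
  h \co x = 0 -> exists y, x = g \co y.
Proof. exact: triangle_exact_mid tr1 _ _. Qed.

Lemma triangle_exact_susp W (x : hom W (S A)) :
  fmap S f \co x = 0 -> exists y, x = h \co y.
Proof. by move=> e; apply: (triangle_exact_mid tr2); rewrite compNl e oppr0. Qed.

End ExactnessRotated.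

(** Dually one maps to a triangle over [0 -> W]; its cone [E] is identified with
    [W] by hand, since the axioms only give the triangle [W -> W -> 0]. *)
Lemma triangle_coexact_mid A B D (f : hom A B) (g : hom B D) (h : hom D (S A))
    W (y : hom B W) :
  triangle f g h -> y \co f = 0 -> exists z, y = z \co g.
Proof.
move=> tr yf; have [Z Z0] := zero_exists C.
have [E [p [q trp]]] := triangle_cone (0 : hom Z W).
have [s ps] : exists s, idm E = p \co s.
  apply: (triangle_exact_right trp).
  by rewrite comp_idr; apply/zero_target/fmap_zero.
have sp : s \co p = idm W.
  have [|x xe] := triangle_exact_mid trp (x := s \co p - idm W).
    by rewrite compBr comp_assoc -ps comp_idl comp_idr subrr.
  by apply/eqP; rewrite -subr_eq0 xe comp0l.
have [|c [e _]] := triangle_fill (a := 0 : hom A Z) (b := y) tr trp.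
  by rewrite yf comp0l.
by exists (s \co c); rewrite -comp_assoc e comp_assoc sp comp_idl.
Qed.

Lemma triangle_coexact_right A B D (f : hom A B) (g : hom B D)
    (h : hom D (S A)) W (y : hom D W) :
  triangle f g h -> y \co g = 0 -> exists z, y = z \co h.
Proof. by move=> /triangle_rotate; apply: triangle_coexact_mid. Qed.

Lemma triangle_coexact_susp A B D (f : hom A B) (g : hom B D)
    (h : hom D (S A)) W (y : hom (S A) W) :
  triangle f g h -> y \co h = 0 -> exists z, y = z \co fmap S f.
Proof.
move=> /triangle_rotate tr yh; have [z ->] := triangle_coexact_right tr yh.
by exists (- z); rewrite compNl compNr.
Qed.

Lemma split_triangle A B D (u : hom A B) (v : hom B D) :
  triangle u v 0 -> is_biproduct A D B.
Proof.
move=> tr; have [s vs] : exists s, idm D = v \co s.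
  by apply: (triangle_exact_right tr); rewrite comp0l.
have u_mono W (x : hom W A) : u \co x = 0 -> x = 0.
  move=> ux; apply: susp_inj; rewrite fmap0.
  have [|y ->] := triangle_exact_susp tr (x := fmap S x).
    by rewrite -fmap_comp ux fmap0.
  by rewrite comp0l.
have [r re] : exists r, idm B - s \co v = u \co r.
  apply: (triangle_exact_mid tr).
  by rewrite compBr comp_idr comp_assoc -vs comp_idl subrr.
have vu := triangle_comp12 tr.
exists u, s, r, v; split=> //.
- apply/eqP; rewrite -subr_eq0; apply/eqP/u_mono.
  by rewrite compBr comp_assoc -re compBl comp_idl -comp_assoc vu comp0r subr0
    comp_idr subrr.
- apply: u_mono.
  by rewrite comp_assoc -re compBl comp_idl -comp_assoc -vs comp_idr subrr.
- by rewrite -re subrK.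
Qed.

(** The cone of [h] is isomorphic to a suspension, and rotating back through this
    isomorphism desuspends the triangle. *)
Lemma triangle_cocone D A (h : hom D (S A)) :
  exists B (f : hom A B) (g : hom B D), triangle f g h.
Proof.
have [E [p [q tr]]] := triangle_cone h.
have [B [i ii]] := equivalence_surj equivS E.
have [j [ji ij ij']] := is_iso_inv ii.
have [f fe] := equivalence_full equivS (- (j \co p)).
have [g ge] := equivalence_full equivS (- (q \co i)).
exists B, f, g; apply/triangle_rotate/triangle_rotate.
apply: (triangle_iso (idm_iso _) (idm_iso _) ij' _ _ _ tr).
- by rewrite comp_idl comp_idr.
- by rewrite fe opprK comp_idr.
- by rewrite ge opprK fmap_id comp_idl -comp_assoc ij comp_idr.
Qed.

Lemma triangle_fiber A D (f : hom A D) :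
  exists B (a : hom B A) (h : hom D (S B)), triangle a f h.
Proof.
have [E [g [q tr]]] := triangle_cone f.
have [B [i ii]] := equivalence_surj equivS E.
have [j [ji ij ij']] := is_iso_inv ii.
have [a ae] := equivalence_full equivS (- (q \co i)).
exists B, a, (j \co g); apply/triangle_rotate.
apply: (triangle_iso (idm_iso _) (idm_iso _) ij' _ _ _ tr).
- by rewrite comp_idl comp_idr.
- by rewrite comp_idr.
- by rewrite ae opprK fmap_id comp_idl -comp_assoc ij comp_idr.
Qed.

(** The octahedron puts the cone [G] of [g \co f] into a triangle on [E] and [F]
    whose connecting morphism is [fmap S f' \co g'']. *)
Lemma octahedral_split A B D E F G (f : hom A B) (f' : hom B E)
    (f'' : hom E (S A)) (g : hom B D) (g' : hom D F) (g'' : hom F (S B))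
    (h' : hom D G) (h'' : hom G (S A)) :
  triangle f f' f'' -> triangle g g' g'' -> triangle (g \co f) h' h'' ->
  fmap S f' \co g'' = 0 -> is_biproduct E F G.
Proof.
move=> tf tg th e; have [u [v [tr _ _ _ _]]] := triangle_octahedral tf tg th.
by rewrite e in tr; apply: split_triangle tr.
Qed.

Lemma triangle_susp A B D (f : hom A B) (g : hom B D) (h : hom D (S A)) :
  triangle f g h -> triangle (fmap S f) (fmap S g) (- fmap S h).
Proof.
do 3!move=> /triangle_rotate; move=> tr.
have isoN X : is_iso (- idm (S X)).
  by exists (- idm (S X)); rewrite compNl compNr opprK comp_idl.
apply: (triangle_iso (idm_iso _) (isoN B) (idm_iso _) _ _ _ tr).
- by rewrite comp_idr compNl compNr opprK comp_idl.
- by rewrite comp_idl compNr comp_idr.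
- by rewrite fmap_id comp_idl comp_idr.
Qed.

(** ** Iterated suspension *)

Fixpoint susp_map (i : nat) A B (f : hom A B) :
    hom (susp_iter i A) (susp_iter i B) :=
  if i is j.+1 then fmap S (susp_map j f) else f.

Lemma susp_map_id i A : susp_map i (idm A) = idm (susp_iter i A).
Proof. by elim: i => //= i ->; rewrite fmap_id. Qed.

Lemma susp_map_comp i A B D (g : hom B D) (f : hom A B) :
  susp_map i (g \co f) = susp_map i g \co susp_map i f.
Proof. by elim: i => //= i ->; rewrite fmap_comp. Qed.

Lemma susp_mapB i A B (f g : hom A B) :
  susp_map i (f - g) = susp_map i f - susp_map i g.
Proof. by elim: i => //= i ->; rewrite fmapB. Qed.

Lemma susp_mapZD i A B c (f g : hom A B) :
  susp_map i (c *: f + g) = c *: susp_map i f + susp_map i g.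
Proof. by elim: i => //= i ->; rewrite (fmap_linear S). Qed.

Lemma susp_map0 i A B : susp_map i (0 : hom A B) = 0.
Proof. by elim: i => //= i ->; rewrite fmap0. Qed.

Lemma susp_map_inj i A B (f g : hom A B) :
  susp_map i f = susp_map i g -> f = g.
Proof. by elim: i => //= i IHi /susp_inj. Qed.

Lemma susp_map_full i A B (h : hom (susp_iter i A) (susp_iter i B)) :
  exists f, susp_map i f = h.
Proof.
elim: i h => [|i IHi] h; first by exists h.
have [h' <-] := equivalence_full equivS h.
by have [f <-] := IHi h'; exists f.
Qed.

Lemma triangle_susp_iter i A B D (f : hom A B) (g : hom B D) (h : hom D (S A)) :
  triangle f g h ->
  exists hi, triangle (susp_map i f) (susp_map i g) hi.
Proof.
elim: i => [|i IHi] tr; first by exists h.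
by have [hi /triangle_susp tri] := IHi tr; exists (- fmap S hi).
Qed.

Lemma susp_iter_hom0 i j A B :
  (forall f : hom A (susp_iter j B), f = 0) ->
  forall f : hom (susp_iter i A) (susp_iter (i + j) B), f = 0.
Proof.
move=> v; elim: i => [|i IHi] f //=.
have [f' <-] := equivalence_full equivS f.
by rewrite [f']IHi fmap0.
Qed.

End Triangles.

(** * Serre duality *)

Section SerreDuality.
Variables (k : fieldType) (C : lincat k) (Se : serre_functor C).
Implicit Types A B : C.

Lemma serre_iso0 A B (f : hom A B) : serre_iso (0 : hom B (Se A)) f = 0.
Proof.
apply: (addrI (serre_iso (0 : hom B (Se A)) f)).
by rewrite addr0 -[X in X + _]mul1r -serre_iso_linear scale1r addr0.
Qed.

Lemma serre_compl A B B' (b : hom B B') (f : hom A B) (g : hom B' (Se A)) :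
  serre_iso g (b \co f) = serre_iso (g \co b) f.
Proof.
have := serre_iso_natural (idm A) b f g.
by rewrite comp_idr fmap_id comp_idl.
Qed.

Lemma serre_compr A A' B (a : hom A' A) (f : hom A B) (g : hom B (Se A')) :
  serre_iso g (f \co a) = serre_iso (fmap Se a \co g) f.
Proof.
have := serre_iso_natural a (idm B) f g.
by rewrite comp_idl comp_idr.
Qed.

(** Functionals on [C(A, B)] are morphisms [B -> S A], so these separate points
    from subspaces. *)
Lemma serre_separates A B (V : hom A B -> Prop) (x : hom A B) :
  hom_finite C -> subspace V -> ~ V x ->
  exists g : hom B (Se A),
    (forall v, V v -> serre_iso g v = 0) /\ serre_iso g x != 0.
Proof.
move=> hf sV nVx.
have [phi [phiV phix]] := separating_functional (finite_dim_hom hf A B) sV nVx.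
have [g [ge _]] := serre_iso_bijective Se phi; exists g.
by rewrite ge; split=> // v /phiV; rewrite ge.
Qed.

End SerreDuality.

(** * Auslander-Reiten angles *)

Section AuslanderReiten.
Variables (k : fieldType) (C : tricat k) (sk : skeleton C).
Variables (Se : serre_functor C) (T : subcategory C) (m : nat).
Implicit Types A B D E Z : C.
Notation S := (susp C).
Notation n := m.+1.

Hypothesis m_gt0 : (0 < m)%N.
Hypothesis hom_fin : hom_finite C.
Hypothesis split_idem : idempotent_complete C.
Hypothesis addT : additive_subcategory T.
Hypothesis boundT : locally_bounded sk T.
Hypothesis ctT : cluster_tilting n T.

Lemma ct_hom0 i l A B : T A -> T B -> (i < l)%N -> (l - i <= m)%N ->
  forall f : hom (susp_iter i A) (susp_iter l B), f = 0.
Proof.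
move=> TA TB il lim; rewrite -(subnKC (ltnW il)); apply: susp_iter_hom0.
by case: ctT => _ /(_ B) [/(_ TB) v _] _; apply: v => //; lia.
Qed.

(** A triangle that ends in a prescribed object: one floor of the tower from which
    an Auslander-Reiten angle is built. *)
Record right_triangle E := RightTriangle {
  rt_ker : C;
  rt_mid : C;
  rt_alpha : hom rt_ker rt_mid;
  rt_beta : hom rt_mid E;
  rt_gamma : hom E (S rt_ker);
  rt_triangle : triangle rt_alpha rt_beta rt_gamma
}.


Lemma right_triangle_of E (P : forall A, hom A E -> Prop) :
  (exists A f, P A f) -> exists t : right_triangle E, P _ (rt_beta t).
Proof.
move=> [A [f Pf]]; have [B [a [h tr]]] := triangle_fiber f.
by exists (RightTriangle tr).
Qed.

Section Tower.
Variables (Y : C) (bottom : right_triangle Y).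
Variable step : forall E, right_triangle E.

Hypothesis TY : T Y.
Hypothesis indY : indecomposable Y.
Hypothesis bottom_split : right_almost_split T (rt_beta bottom).
Hypothesis bottom_minimal : right_minimal (rt_beta bottom).
Hypothesis step_approx : forall E, right_approximation T (rt_beta (step E)).
Hypothesis step_minimal : forall E, right_minimal (rt_beta (step E)).

Fixpoint tower (i : nat) : {E : C & right_triangle E} :=
  if i is j.+1 then
    let E := rt_ker (projT2 (tower j)) in existT _ E (step E)
  else existT _ Y bottom.

Let X i : C := projT1 (tower i).
Let t i : right_triangle (X i) := projT2 (tower i).
Let M i : C := rt_mid (t i).
Let alpha i : hom (X i.+1) (M i) := rt_alpha (t i).
Let beta i : hom (M i) (X i) := rt_beta (t i).
Let gamma i : hom (X i) (S (X i.+1)) := rt_gamma (t i).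

Let tri i : triangle (alpha i) (beta i) (gamma i) := rt_triangle (t i).

Let TM i : T (M i).
Proof.
by case: i => [|i]; [case: bottom_split|case: (step_approx (X i.+1))].
Qed.

Let beta_min i : right_minimal (beta i).
Proof. by case: i => [|i]; [exact: bottom_minimal|exact: step_minimal]. Qed.

(** Dimension shift along the triangles: [C(A, Sigma^j X_i)] is a quotient of
    [C(A, Sigma^(j-1) X_(i-1))], so only the diagonal [j = i], which descends
    from [C(A, Y)], can survive.  At [j = 1] and [i > 1] the quotient is zero as
    all morphisms to [X_(i-1)] lift to its approximation. *)
Lemma tower_hom0 i j A (f : hom A (susp_iter j (X i))) :
  T A -> (1 <= j <= m)%N -> j <> i -> f = 0.
Proof.
move=> TA; elim: i j f => [|i IHi] [//|j] f jm ji.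
  by apply: (@ct_hom0 0 j.+1 A Y) => //; lia.
have [h trj] := triangle_susp_iter j (tri i).
have [|y ->] := triangle_exact_susp trj (x := f).
  by apply: (@ct_hom0 0 j.+1 A (M i)) => //; lia.
case: j {jm} h trj f y ji (IHi j) (jm) => [|j] h trj f y ji IHj jm; last first.
  by rewrite (IHj y) ?comp0r //; lia.
case: i {IHi IHj} ji h trj f y => [//|i] _ h trj f y.
have [_ /(_ A y TA) [z ->]] := step_approx (X i.+1).
by rewrite comp_assoc (triangle_comp23 trj) comp0l.
Qed.

(** At the top of the tower the diagonal index [j = n] is out of range. *)
Lemma tower_top : T (X n).
Proof.
case: ctT => _ /(_ (X n)) [_ TX] _; apply: TX => j jn A TA f.
by apply: (@tower_hom0 n j A f TA); lia.
Qed.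

(** The same shift in the other variable starts from [C(Y, Sigma^j B) = 0] and
    loses one degree per floor. *)
Lemma tower_cohom0 i j B (f : hom (X i) (susp_iter j B)) :
  T B -> (1 <= j)%N -> (i + j <= m)%N -> f = 0.
Proof.
move=> TB; elim: i j f => [|i IHi] j f j1 ij.
  by apply: (@ct_hom0 0 j Y B) => //; lia.
have fg : fmap S f \co gamma i = 0 by apply: (IHi j.+1) => //; lia.
have [z ze] := triangle_coexact_susp (tri i) fg.
have [z' z'z] := equivalence_full (susp_equivalence C) z.
have -> : f = z' \co alpha i by apply: susp_inj; rewrite ze -z'z fmap_comp.
rewrite (@ct_hom0 0 j (M i) B _ _ _ _ z') ?comp0l //; lia.
Qed.

Lemma tower_left_approximation i :
  (i < m)%N -> left_approximation T (alpha i).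
Proof.
move=> im; split=> // B f TB.
have fg : fmap S f \co gamma i = 0.
  by apply: (@tower_cohom0 i 1 B) => //; lia.
have [z ze] := triangle_coexact_susp (tri i) fg.
have [z' z'z] := equivalence_full (susp_equivalence C) z.
by exists z'; apply: susp_inj; rewrite ze -z'z fmap_comp.
Qed.

(** The left approximation out of [X_(i+1)] would send such a summand to a summand
    of the middle term that the right minimal [beta i] kills. *)
Lemma tower_no_summand i Z (s : hom Z (X i.+1)) (r : hom (X i.+1) Z) :
  (i < m)%N -> T Z -> r \co s = idm Z -> is_zero Z.
Proof.
move=> im TZ rs; have [_ /(_ Z r TZ) [r' re]] := tower_left_approximation im.
apply: (@right_minimal_kernel _ _ _ _ _ (beta i) (alpha i \co s) r').
- exact: beta_min.
- by rewrite comp_assoc -re.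
- by rewrite comp_assoc (triangle_comp12 (tri i)) comp0l.
Qed.

(** A summand of the middle term on which [beta i] is a split monomorphism would
    be a summand of [X_i] in [T]; for [i = 0] it would be all of [Y] and split
    [beta 0]. *)
Lemma tower_left_minimal i : (i <= m)%N -> left_minimal (alpha i).
Proof.
move=> im g ga; have [z ze] : exists z, idm (M i) - g = z \co beta i.
  by apply: (triangle_coexact_mid (tri i)); rewrite compBl comp_idl ga subrr.
have -> : g = idm (M i) - z \co beta i by rewrite -ze subKr.
apply: (radical_is_iso1B hom_fin split_idem) => Z p s pbs [r rs].
have TZ : T Z by apply: (retract_sub split_idem addT _ (TM i)); exists s, r.
rewrite -comp_assoc in pbs.
case: i im g ga z ze p s r rs pbs => [_|i im] g _ z _ p s _ _ pbs; last first.
  exact: tower_no_summand pbs.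
apply: contrapT => nZ; have e := retract_indec split_idem indY pbs nZ.
case: bottom_split => _ _ nb _; apply: nb.
by exists (s \co p); rewrite comp_assoc.
Qed.

(** ** The n-extension of [Y] by the top of the tower *)

Let delta_ex i : exists h : hom (susp_iter i (X i)) (susp_iter i.+1 (X i.+1)),
  triangle (susp_map i (alpha i)) (susp_map i (beta i)) h :=
  triangle_susp_iter i (tri i).

Let delta i := sval (cid (delta_ex i)).

Let triS i :
  triangle (susp_map i (alpha i)) (susp_map i (beta i)) (delta i) :=
  svalP (cid (delta_ex i)).

(** The Yoneda product of all connecting morphisms of the tower. *)
Fixpoint ext_class (i : nat) : hom Y (susp_iter i (X i)) :=
  if i is j.+1 then delta j \co ext_class j else idm Y.

Lemma ext_class_beta i : ext_class i.+1 \co beta 0 = 0.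
Proof.
elim: i => [|i IHi] /=; last by rewrite -comp_assoc IHi comp0r.
by rewrite comp_idr; apply: (triangle_comp23 (triS 0)).
Qed.

(** A vanishing product would lift through a group [C(Y, Sigma^i M)] that is zero
    for [i > 0], down to a section of [beta 0]. *)
Lemma ext_class_neq0 i : (i <= m)%N -> ext_class i.+1 <> 0.
Proof.
elim: i => [_|i IHi im] /= e.
  have [y ye] := triangle_exact_right (triS 0) e.
  by case: bottom_split => _ _ nb _; apply: nb; exists y.
have [y ye] := triangle_exact_right (triS i.+1) e.
apply: IHi; first exact: ltnW.
rewrite /= ye.
rewrite (@ct_hom0 0 i.+1 Y (M i.+1) _ _ _ _ y) ?comp0r //; lia.
Qed.

(** Descending through the tower, the obstructions to cancel [ext_class] lie in
    groups [C(Sigma^i M, Sigma^n B)] with [0 < i < n], which vanish. *)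
Lemma ext_class_kernel i B (u : hom (susp_iter i.+1 (X i.+1)) (susp_iter n B)) :
  T B -> (i <= m)%N -> u \co ext_class i.+1 = 0 ->
  exists u', u = u' \co susp_map i.+1 (alpha i).
Proof.
move=> TB; elim: i u => [|i IHi] u im ue; last first.
  apply: (triangle_coexact_susp (triS i.+1)).
  rewrite /= comp_assoc in ue; have [|u' ->] := IHi _ _ ue; first exact: ltnW.
  rewrite (@ct_hom0 i.+1 n (M i) B _ _ _ _ u') ?comp0l //; lia.
apply: (triangle_coexact_susp (triS 0)).
by rewrite /= comp_idr in ue.
Qed.

Lemma ext_class_factor B (w : hom (X n) B) : T B ->
  susp_map n w \co ext_class n = 0 -> exists w', w = w' \co alpha m.
Proof.
move=> TB we; have [u' ue] := ext_class_kernel TB (leqnn m) we.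
have [w' we'] := susp_map_full u'.
by exists w'; apply: (@susp_map_inj _ _ n); rewrite ue -we' susp_map_comp.
Qed.

(** Suppose that [theta] detects the extension class.  The preimage [W] of
    its source under the Serre functor lies in [T], as by duality the groups
    [C(W, Sigma^i A)] vanish.  If the preimage [W -> Y] of [theta] were not a
    split epimorphism it would factor through [beta 0], which the extension class
    kills; so the value at the extension class would be zero. *)
Lemma ext_class_dual_split
    (theta : hom (susp_iter n (X n)) (Se Y)) :
  serre_iso theta (ext_class n) != 0 -> split_epi theta.
Proof.
move=> nz.
have [W [w wi]] := equivalence_surj (serre_equivalence Se) (susp_iter n (X n)).
have [w' [w'w ww' _]] := is_iso_inv wi.
have [q qe] := equivalence_full (serre_equivalence Se) (theta \co w).
have TW : T W.
  case: ctT => _ _ /(_ W) [_ TW]; apply: TW => i im A TA f.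
  apply: contrapT => nf.
  have sV : subspace (fun y : hom W (susp_iter i A) => y = 0).
    by split=> // c x y -> ->; rewrite scaler0 addr0.
  have [g [_ /eqP gf]] := serre_separates Se hom_fin sV nf.
  apply: gf; have wg : w \co g = 0.
    by apply: (ct_hom0 TA tower_top); lia.
  have -> : g = w' \co (w \co g) by rewrite comp_assoc w'w comp_idl.
  by rewrite wg comp0r serre_iso0.
have [[y qy]|nq] := pselect (split_epi q).
  exists (w \co fmap Se y).
  by rewrite comp_assoc -qe -fmap_comp qy fmap_id.
case: bottom_split => _ _ _ /(_ W q TW nq) [q' qq'].
case/eqP: nz; have -> : theta = fmap Se (beta 0) \co (fmap Se q' \co w').
  by rewrite comp_assoc -fmap_comp -qq' qe -comp_assoc ww' comp_idr.
by rewrite -serre_compr ext_class_beta raddf0.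
Qed.

(** If [g] does not factor through [alpha m] then [eta], the push-out of the
    extension class along [g], is non-zero.  Then the extension class is in turn
    a push-out of [eta] along some [v]: a functional that vanishes on all
    push-outs of [eta] but not on the extension class is given by a split
    epimorphism [theta], through which every functional on the group of [eta]
    factors, so that [eta] would be zero.  Hence [v g] fixes the extension class,
    so it is [1] up to a morphism through [alpha m], and this makes it
    invertible. *)
Lemma tower_left_almost_split : left_almost_split T (alpha m).
Proof.
split=> //; first exact: tower_top.
  move=> [r ra]; apply: (ext_class_neq0 (leqnn m)).
  rewrite -[LHS]comp_idl -(susp_map_id n) -ra susp_map_comp -comp_assoc.
  have -> : susp_map n (alpha m) \co ext_class n = 0; last exact: comp0r.
  by rewrite /= comp_assoc (triangle_comp31 (triS m)) comp0l.
move=> B g TB ng; apply: contrapT => nfac.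
pose eta := susp_map n g \co ext_class n.
have eta0 : eta <> 0.
  by move=> /(ext_class_factor TB) [w gw]; apply: nfac; exists w.
have [v ve] : exists v, ext_class n = susp_map n v \co eta.
  apply: contrapT => nv.
  pose V y := exists v : hom B (X n), y = susp_map n v \co eta.
  have sV : subspace V.
    split=> [|c _ _ [x ->] [y ->]]; first by exists 0; rewrite susp_map0 comp0l.
    by exists (c *: x + y); rewrite susp_mapZD (comp_linearl eta).
  have [theta [thV the]] := serre_separates Se hom_fin sV nv.
  have [s ths] := ext_class_dual_split the.
  have eta_sep : exists x : hom _ (Se Y), serre_iso x eta != 0.
    have sV0 : subspace (fun y : hom Y (susp_iter n B) => y = 0).
      by split=> // c x y -> ->; rewrite scaler0 addr0.
    by have [x [_ xe]] := serre_separates Se hom_fin sV0 eta0; exists x.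
  have [x /eqP xe] := eta_sep; apply: xe.
  have [v ve] := susp_map_full (s \co x).
  rewrite -(thV (susp_map n v \co eta)); last by exists v.
  by rewrite ve serre_compl comp_assoc ths comp_idl.
have [u ue] : exists u, idm (X n) - v \co g = u \co alpha m.
  apply: ext_class_factor; first exact: tower_top.
  by rewrite susp_mapB susp_map_id compBl comp_idl susp_map_comp -comp_assoc
    -/eta -ve subrr.
have [h [h1 _]] : is_iso (idm (X n) - u \co alpha m).
  apply: is_iso1B_swap; apply: beta_min.
  by rewrite compBr comp_idr comp_assoc (triangle_comp12 (tri m)) comp0l subr0.
apply: ng; exists (h \co v).
by rewrite -comp_assoc -[v \co g](subKr (idm (X n))) ue.
Qed.

Lemma tower_angle : exists a : ar_angle T n, ar_half a 0 = Y.
Proof.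
have first_beta : right_almost_split T (beta 0) /\ right_minimal (beta 0) by [].
have last_alpha i : i.+1 = n ->
    left_almost_split T (alpha i) /\ left_minimal (alpha i).
  by move=> [->]; split;
    [exact: tower_left_almost_split|exact: tower_left_minimal].
have approx_beta i : (0 < i < n)%N ->
    right_approximation T (beta i) /\ right_minimal (beta i).
  by case: i => // i _; split; [exact: step_approx|exact: step_minimal].
have approx_alpha i : (i.+1 < n)%N ->
    left_approximation T (alpha i) /\ left_minimal (alpha i).
  move=> im; split; first exact: tower_left_approximation.
  by apply: tower_left_minimal; lia.
by exists (ArAngle (TY : T (X 0)) tower_top (fun i _ => TM i) (fun i _ => tri i)
  first_beta last_alpha approx_beta approx_alpha).
Qed.

End Tower.

Lemma ar_angle_exists Y : T Y -> indecomposable Y ->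
  exists a : ar_angle T n, ar_half a 0 = Y.
Proof.
move=> TY indY.
have [bot [bs bm]] := right_triangle_of
  (minimal_right_almost_split hom_fin split_idem addT boundT TY indY).
have ex E : exists t : right_triangle E,
    right_approximation T (rt_beta t) /\ right_minimal (rt_beta t).
  apply: (right_triangle_of (P := fun A (f : hom A E) =>
    right_approximation T f /\ right_minimal f)).
  apply: (minimal_right_approximation hom_fin split_idem E addT).
  by case: ctT => [[]].
pose step E := sval (cid (ex E)).
have stepP E : right_approximation T (rt_beta (step E)) /\
    right_minimal (rt_beta (step E)) by rewrite /step; case: cid.
exact: (tower_angle TY indY bs bm (fun E => (stepP E).1)
  (fun E => (stepP E).2)).
Qed.

End AuslanderReiten.

(** * Grothendieck groups *)

Section GeneratedSubgroups.
Variables (G : zmodType) (P : G -> Prop).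

Lemma generatedD x y : generated P x -> generated P y -> generated P (x + y).
Proof.
move=> gx gy; rewrite -[y]opprK -[- y]sub0r.
by apply: generatedB => //; apply: generatedB => //; apply: generated0.
Qed.

End GeneratedSubgroups.

Lemma alternating_sum (V : zmodType) (x m : nat -> V) (n : nat) :
  \sum_(i < n.+2)
    (if (i : nat) is j.+1 then (if j == n then x n else m j) else x 0%N)
      *~ (-1) ^+ i =
  \sum_(j < n) (x j - m j + x j.+1) *~ (-1) ^+ j.
Proof.
rewrite big_ord_recl big_ord_recr /= eqxx.
have -> : \sum_(i < n) (if bump 0 i == n.+1 then x n else m i)
    *~ (-1) ^+ bump 0 i = \sum_(i < n) - (m i *~ (-1) ^+ i).
  apply: eq_bigr => i _; rewrite /bump /= add1n eqSS ltn_eqF //.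
  by rewrite exprS mulN1r mulrNz.
have -> : \sum_(j < n) (x j - m j + x j.+1) *~ (-1) ^+ j =
    \sum_(j < n) - (m j *~ (-1) ^+ j) +
    \sum_(j < n) (x j + x j.+1) *~ (-1) ^+ j.
  rewrite -big_split; apply: eq_bigr => j _ /=.
  by rewrite -mulNrz -mulrzDl addrCA addrA.
rewrite addrCA; congr (_ + _); rewrite expr0 mulr1z /bump /= add1n.
elim: n => [|n IHn]; first by rewrite big_ord0 expr1 mulrN1z subrr.
rewrite big_ord_recr /= -IHn mulrzDl -!addrA; congr (_ + _).
rewrite exprS mulN1r mulrNz exprS mulN1r mulrNz opprK.
by rewrite mulrNz addrA addNr add0r.
Qed.

Section Grothendieck.
Variables (k : fieldType) (C : tricat k) (sk : skeleton C).
Implicit Types A B D E : C.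
Notation S := (susp C).
Local Notation cls D A := (K0_class (sk := sk) D A).

Lemma K0sp_biproduct A B D :
  is_biproduct A B D -> class_sp sk D = class_sp sk A + class_sp sk B.
Proof.
move=> bp; rewrite /class_sp -raddfD; apply/eqP.
rewrite -[_ == _]Quotient.idealrBE; apply/asboolP/generated_in.
by exists A, B, D; rewrite opprD addrA.
Qed.

Lemma K0_biproduct (F : subcategory C) A B D :
  is_biproduct A B D -> cls F D = cls F A + cls F B.
Proof. by move=> bp; rewrite /K0_class (K0sp_biproduct bp) raddfD. Qed.

Lemma K0_triangle (F : subcategory C) A B D (f : hom A B) (g : hom B D)
    (h : hom D (S A)) :
  relative_triangle F f g h -> cls F A - cls F B + cls F D = 0.
Proof.
move=> rt; rewrite /K0_class -raddfB -raddfD -[0](raddf0 (K0_proj (sk := sk) F)).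
apply/K0_projP; rewrite subr0; apply: generated_in.
by exists A, B, D, f, g, h.
Qed.

(** ** Triangles whose connecting morphism is a composite *)

(** The image of [C(-, delta h)] is a subfunctor of the image of [C(-, delta)],
    and the quotient is the image of [C(-, Sigma f' delta)].  Passing from a
    triangle to the image functor of its connecting morphism thus behaves
    additively in the Grothendieck group.  [W] is the homotopy pushout of [f] and
    [f'], an extension of [D] by [B] that splits as [Sigma f \co delta = 0]. *)
Lemma defect_comp A B B' D E (f : hom A B) (g : hom B E) (delta : hom E (S A))
    (h : hom D E) (f' : hom A B') (g' : hom B' D) (F : subcategory C) :
  triangle f g delta -> triangle f' g' (delta \co h) ->
  exists (W : C) (u : hom B' W) (v : hom W E),
    triangle u v (- fmap S f' \co delta) /\
    cls F A - cls F B + cls F E =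
    (cls F A - cls F B' + cls F D) + (cls F B' - cls F W + cls F E).
Proof.
move=> tr tr'; have [W [u [v trW]]] := triangle_cocone (- fmap S f' \co delta).
exists W, u, v; split=> //.
(* the octahedron on [- fmap S f' \co delta] *)
have bp : is_biproduct B D W.
  apply: (equivalence_reflects_biproduct (susp_equivalence C)).
  apply: (octahedral_split
    ((triangle_rotate _ _ _).1 ((triangle_rotate _ _ _).1 tr))
    ((triangle_rotate _ _ _).1 ((triangle_rotate _ _ _).1
      ((triangle_rotate _ _ _).1 tr')))).
    exact: (triangle_rotate _ _ _).1 ((triangle_rotate _ _ _).1 trW).
  rewrite fmapN compNl compNr opprK -fmap_comp comp_assoc.
  by rewrite (triangle_comp31 tr) comp0l fmap0.
rewrite (K0_biproduct F bp) opprD.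
rewrite !addrA [RHS](ACl (1*5*7*(2*4)*(3*6))) /=.
by rewrite addNr subrr !addr0.
Qed.

(** [W] is the homotopy pullback of [g] and [beta]; the extension of [M] by [A]
    that it carries has connecting morphism [phi \co beta] and hence splits. *)
Lemma pullback_triangle A B D X M (f : hom A B) (g : hom B D)
    (phi : hom D (S A)) (alpha : hom X M) (beta : hom M D)
    (gamma : hom D (S X)) :
  triangle f g phi -> triangle alpha beta gamma -> phi \co beta = 0 ->
  exists (W : C) (u : hom X W) (v : hom W B),
    triangle u v (gamma \co g) /\ is_biproduct A M W.
Proof.
move=> tr tr' pb; have [W [u [v trW]]] := triangle_cocone (gamma \co g).
exists W, u, v; split=> //.
apply: (equivalence_reflects_biproduct (susp_equivalence C)).
apply: (octahedral_split ((triangle_rotate _ _ _).1 tr)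
  ((triangle_rotate _ _ _).1 ((triangle_rotate _ _ _).1 tr'))).
  exact: (triangle_rotate _ _ _).1 ((triangle_rotate _ _ _).1 trW).
by rewrite compNr -fmap_comp pb fmap0 oppr0.
Qed.

(** ** Auslander-Reiten angles in the Grothendieck group *)

Section Angles.
Variables (T : subcategory C) (n : nat).
Hypothesis n_gt0 : (0 < n)%N.
Variable a : ar_angle T n.

(** All triangles of the angle but the first belong to the relative structure of
    [F], as their second morphisms are right [T]-approximations; so the
    alternating sum collapses to the first one. *)
Lemma ar_angle_sum (F : subcategory C) :
  sub_incl F T ->
  \sum_(i < n.+2) cls F (ar_obj a i) *~ (-1) ^+ i =
  cls F (ar_half a 0) - cls F (ar_mid a 0) + cls F (ar_half a 1).
Proof.
move=> FT; transitivity (\sum_(j < n)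
    (cls F (ar_half a j) - cls F (ar_mid a j) + cls F (ar_half a j.+1))
      *~ (-1) ^+ j).
  rewrite -(alternating_sum (fun i => cls F (ar_half a i))
    (fun i => cls F (ar_mid a i))).
  apply: eq_bigr => -[[|i] im] _ //=; congr (_ *~ _).
  by case: eqP.
rewrite (bigD1 (Ordinal n_gt0)) //= expr0 mulr1z big1 ?addr0 // => i i0.
have im : (0 < i < n)%N by rewrite lt0n ltn_ord andbT.
rewrite addrAC [cls F _ + cls F _]addrC addrAC.
rewrite (@K0_triangle F _ _ _ (ar_alpha a i) (ar_beta a i) (ar_gamma a i))
  ?mul0rz //.
have tr := ar_triangle a (ltn_ord i); split=> // A h /FT TA.
have [[_ /(_ A h TA) [x ->]] _] := ar_beta_approximation a im.
by rewrite comp_assoc (triangle_comp23 tr) comp0l.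
Qed.

Lemma ar_gamma_beta : ar_gamma a 0 \co ar_beta a 0 = 0.
Proof. exact: triangle_comp23 (ar_triangle a n_gt0). Qed.

(** Both [phi] and [gamma] have as image functor on [T] the simple functor at the
    end term, so the two triangles have the same class: the homotopy pullback
    is a triangle of the relative structure of [T], because a morphism to [B]
    from an object of [T] is not a split epimorphism after composition with [g],
    as [phi <> 0]. *)
Lemma simple_defect A B (f : hom A B) (g : hom B (ar_half a 0))
    (phi : hom (ar_half a 0) (S A)) :
  triangle f g phi -> phi \co ar_beta a 0 = 0 -> phi <> 0 ->
  cls T A - cls T B + cls T (ar_half a 0) =
  \sum_(i < n.+2) cls T (ar_obj a i) *~ (-1) ^+ i.
Proof.
move=> tr pb p0; have [[_ _ _ split_factor] _] := ar_beta_first a.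
have [W [u [v [trW bp]]]] := pullback_triangle tr (ar_triangle a n_gt0) pb.
have := @K0_triangle T _ _ _ u v _ (conj trW _).
rewrite (K0_biproduct T bp) ar_angle_sum // => e.
have {}e : cls T (ar_half a 1) - (cls T A + cls T (ar_mid a 0)) + cls T B = 0.
  apply: e => D h TD; have [[s gs]|ns] := pselect (split_epi (g \co h)).
    case: p0; rewrite -[phi]comp_idr -gs !comp_assoc.
    by rewrite (triangle_comp23 tr) !comp0l.
  have [x gx] := split_factor D (g \co h) TD ns.
  by rewrite -comp_assoc gx comp_assoc ar_gamma_beta comp0l.
rewrite -[LHS]addr0 -e opprD !addrA (ACl (3*6*4*(1*5)*(2*7))) /=.
by rewrite subrr addNr !addr0.
Qed.

End Angles.

End Grothendieck.

(** * The kernel of the canonical surjection *)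

Section Kernel.
Variables (k : fieldType) (C : tricat k) (sk : skeleton C).
Variables (Se : serre_functor C) (X T Y : subcategory C) (XT : sub_incl X T).
Variable m : nat.
Implicit Types A B D E : C.
Notation S := (susp C).
Notation n := m.+1.
Local Notation cls F A := (K0_class (sk := sk) F A).

Hypothesis m_gt0 : (0 < m)%N.
Hypothesis hom_fin : hom_finite C.
Hypothesis split_idem : idempotent_complete C.
Hypothesis addX : additive_subcategory X.
Hypothesis addT : additive_subcategory T.
Hypothesis boundT : locally_bounded sk T.
Hypothesis ctT : cluster_tilting n T.
Hypothesis indecT : forall i : sk, indec T i <-> indec X i \/ indec Y i.
Hypothesis disjXY : forall i : sk, ~ (indec X i /\ indec Y i).

Definition ar_generator (z : K0 sk T) : Prop :=
  exists (y : sk) (a : ar_angle T n),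
    [/\ indec Y y, ar_obj a 0 = sk_obj y
      & z = \sum_(i < n.+2) cls T (ar_obj a i) *~ (-1) ^+ i].

(** An object of [X] has no split epimorphism to an indecomposable object of [Y],
    so also the first triangle of the angle belongs to the structure of [X]. *)
Lemma ar_generator_kernel z : ar_generator z -> canonical sk XT z = 0.
Proof.
move=> [y [a [iY a0 ->]]]; rewrite raddf_sum.
under eq_bigr => i _ do rewrite raddfMz /= canonical_class.
rewrite ar_angle_sum // addrAC [cls X _ + cls X _]addrC addrAC.
apply: (@K0_triangle _ _ _ X _ _ _ (ar_alpha a 0) (ar_beta a 0) (ar_gamma a 0)).
split=> [|A h XA]; first exact: ar_triangle.
have [[_ _ _ fac] _] := ar_beta_first a.
have [[s hs]|ns] := pselect (split_epi h).
  case: (disjXY (conj _ iY)); split; last by case: iY.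
  by rewrite -a0; apply: (retract_sub split_idem addX _ XA); exists s, h.
have [x ->] := fac A h (XT XA) ns.
by rewrite comp_assoc ar_gamma_beta // comp0l.
Qed.

(** Evaluation at a [G] that contains all indecomposables on which the image of
    [C(-, delta)] does not vanish turns the length of this functor into a
    dimension. *)
Let supported A E G (delta : hom E (S A)) : Prop :=
  forall D, T D -> indecomposable D -> (exists h : hom D E, delta \co h <> 0) ->
    retract D G.

Let image A E G (delta : hom E (S A)) (y : hom G (S A)) : Prop :=
  exists x, y = delta \co x.

(** Induction on the size of the image functor of [delta].  If it is not zero on
    [T], it is non-zero at some indecomposable [Q] of [T], which must lie in [Y].
    The morphism [phi : Q -> Sigma A] in the image splits off a subfunctor and
    leaves a smaller quotient; of the subfunctor, the part [phi \co beta] through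
    the radical of [Q] is smaller, and the rest is zero or simple at [Q]. *)
Lemma defect_generated G d A B E (f : hom A B) (g : hom B E)
    (delta : hom E (S A)) :
  triangle f g delta -> (forall D (h : hom D E), X D -> delta \co h = 0) ->
  supported G delta -> ~ has_indep (@image A E G delta) d ->
  generated ar_generator (cls T A - cls T B + cls T E).
Proof.
elim: d A B E f g delta => [|d IHd] A B E f g delta tr dX supp rank.
  by case: rank; apply: has_indep0.
have [dT|ndT] := pselect (forall D, T D -> forall h : hom D E, delta \co h = 0).
  rewrite (@K0_triangle _ _ _ T _ _ _ f g delta); first exact: generated0.
  by split=> // D h /dT.
have [Q [y [h [Qy TQ indQ dh]]]] : exists (Q : C) (y : sk) (h : hom Q E),
    [/\ Q = sk_obj y, T Q, indecomposable Q & delta \co h <> 0].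
  apply: contrapT => none; apply: ndT => D.
  elim/(object_induction hom_fin): D => [D D0 _ h|D indD TD h|].
  - by rewrite (zero_source h D0) comp0r.
  - apply: contrapT => dh; apply: none.
    have [y [p [q [qp pq]]]] := sk_surj sk D.
    have isoD : isomorphic D (sk_obj y) by exists p, q.
    exists (sk_obj y), y, (h \co q); split=> //.
    + by case: addT => Tiso _ _ _; apply: Tiso TD.
    + exact: indecomposable_iso indD.
    + move=> e; apply: dh.
      by rewrite -[h]comp_idr -qp !(comp_assoc _ _ p) e comp0l.
  - move=> A1 A2 D bp I1 I2 TD h.
    have [T1 T2] : T A1 /\ T A2 by case: addT => _ _ _ /(_ _ _ _ bp TD).
    case: bp => i1 [i2 [p1 [p2 [_ _ _ _ e]]]].
    rewrite -[h]comp_idr -e compDr !comp_assoc compDr !comp_assoc.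
    by rewrite -(comp_assoc delta h i1) I1 // -(comp_assoc delta h i2) I2 //
      !comp0l addr0.
have iY : indec Y y.
  have [|[XQ _]|//] := (indecT y).1; first by rewrite /indec -Qy.
  by case: dh; apply: dX; rewrite Qy.
have [a aQ] := ar_angle_exists Se m_gt0 hom_fin split_idem addT boundT ctT TQ indQ.
move: h dh TQ indQ Qy; rewrite -{Q}aQ => h dh TQ indQ Qy.
have [r [s sr]] := supp _ TQ indQ (ex_intro _ h dh).
(* [r : Q -> G] and [s : G -> Q] exhibit [Q] as a summand of the test object,
   so [phi \co s] is a non-zero value of the image functor at [G]. *)
set Q := ar_half a 0 in h dh TQ indQ Qy r s sr.
set phi := delta \co h in dh.
have [B' [f' [g' tr']]] := triangle_cocone phi.
have [W [u [v [trW ->]]]] := defect_comp sk T tr tr'.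
apply: generatedD; last first.
  apply: (IHd _ _ _ _ _ _ trW) => [D x XD|D TD indD [x nx]|].
  - by rewrite -comp_assoc dX // comp0r.
  - by apply: supp => //; exists x => dx; apply: nx; rewrite -comp_assoc dx comp0r.
  - move=> ind; apply: rank.
    apply: (has_indep_ker (f := fun y : hom G (S A) => - fmap S f' \co y)
      (z := phi \co s)) ind.
    + by move=> c p q /=; rewrite (comp_linearr (- fmap S f')).
    + move=> _ [x ->]; exists (delta \co x); last by rewrite comp_assoc.
      by exists x.
    + by exists (h \co s); rewrite comp_assoc.
    + by rewrite compNl comp_assoc (triangle_comp31 tr') comp0l oppr0.
    + apply/eqP => e; apply: dh.
      by rewrite -/phi -[phi]comp_idr -sr comp_assoc e comp0l.
have [[_ _ nsplit _] _] := ar_beta_first a.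
set beta := ar_beta a 0 in nsplit.
have [B2 [f2 [g2 tr2]]] := triangle_cocone (phi \co beta).
have [W2 [u2 [v2 [trW2 ->]]]] := defect_comp sk T tr' tr2.
apply: generatedD.
  have phiE D (x : hom D _) : phi \co beta \co x = delta \co (h \co (beta \co x)).
    by rewrite !comp_assoc.
  apply: (IHd _ _ _ _ _ _ tr2) => [D x XD|D TD indD [x nx]|ind].
  - by rewrite phiE dX.
  - by apply: supp => //; exists (h \co (beta \co x)); rewrite -phiE.
  apply: rank; apply: (has_indep_proper (y := phi \co s)) ind.
  - exact: image_subspace.
  - by move=> _ [x ->]; exists (h \co (beta \co x)); rewrite phiE.
  - by exists (h \co s); rewrite comp_assoc.
  move=> [x e].
  (* [End Q] is local and [beta] is not a split epimorphism, so
     [1 - beta x r] is invertible *)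
  have zero : phi \co (idm Q - beta \co (x \co r)) = 0.
    by rewrite compBr comp_idr !comp_assoc -e -comp_assoc sr comp_idr subrr.
  have [[q [_ bq]]|[q [_ bq]]] :=
    indec_end hom_fin split_idem (beta \co (x \co r)) indQ.
    by apply: nsplit; exists (x \co r \co q); rewrite comp_assoc.
  by apply: dh; rewrite -/phi -[phi]comp_idr -bq comp_assoc zero comp0l.
have [e0|n0] := pselect (- fmap S f2 \co phi = 0).
  rewrite (@K0_triangle _ _ _ T _ _ _ u2 v2 (- fmap S f2 \co phi)).
    exact: generated0.
  by split=> // D x _; rewrite e0 comp0l.
apply: generated_in; exists y, a; split=> //.
apply: (simple_defect sk _ trW2) => //.
by rewrite -comp_assoc compNl (triangle_comp31 tr2) oppr0.
Qed.

(** A right [T]-approximation of the end term [E] bounds the support of the image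
    functor. *)
Lemma relative_defect_generated A B E (f : hom A B) (g : hom B E)
    (delta : hom E (S A)) :
  relative_triangle X f g delta ->
  generated ar_generator (cls T A - cls T B + cls T E).
Proof.
move=> [tr dX]; have [[cfT _] _ _] := ctT.
have [TE [xi [TTE app]]] := cfT E.
have [G [TG supp]] := finite_support hom_fin addT boundT TTE.
have [d nd] := finite_dim_bound (finite_dim_hom hom_fin G (S A)).
apply: (@defect_generated G d _ _ _ _ _ _ tr _ _ (nd _)) => [D h XD|].
  exact: dX.
move=> D TD indD [h dh]; apply: supp => //.
have [x hx] := app D h TD; exists x => x0; apply: dh.
by rewrite hx x0 !comp0r.
Qed.

Lemma kernel_generated x :
  canonical sk XT x = 0 <-> generated ar_generator x.
Proof.
split=> [|gx]; last first.
  elim: gx => [z|| z w _ z0 _ w0]; first exact: ar_generator_kernel.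
    exact: raddf0.
  by rewrite raddfB /= z0 w0 subrr.
have [z ->] := K0_proj_surj x; rewrite canonicalE => z0.
have : generated (relative_relation X) z.
  by rewrite -[z]subr0; apply/K0_projP; rewrite z0 raddf0.
elim=> [w [A [B [E [f [g [delta [rt ->]]]]]]]|| w w' _ gw _ gw'].
- by rewrite raddfD raddfB; apply: relative_defect_generated rt.
- by rewrite raddf0; apply: generated0.
- by rewrite raddfB; apply: generatedB.
Qed.

End Kernel.

Theorem theorem4p11 (k : fieldType) (n : nat) (C : tricat k) (sk : skeleton C)
    (S : serre_functor C) (X T Y : subcategory C) (XT : sub_incl X T) :
  (2 <= n)%N ->
  hom_finite C ->
  idempotent_complete C ->
  additive_subcategory X ->
  additive_subcategory T ->
  contravariantly_finite X ->
  contravariantly_finite T ->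
  locally_bounded sk T ->
  cluster_tilting n T ->
  additive_subcategory Y ->
  rigid Y ->
  (forall i : sk, indec T i <-> indec X i \/ indec Y i) ->
  (forall i : sk, ~ (indec X i /\ indec Y i)) ->
  forall x : K0 sk T,
    canonical sk XT x = 0 <->
    generated
      (fun z : K0 sk T =>
         exists (y : sk) (a : ar_angle T n),
           [/\ indec Y y, ar_obj a 0 = sk_obj y
             & z = \sum_(i < n.+2) K0_class T (ar_obj a i) *~ (-1) ^+ i])
      x.
Proof.
case: n => [//|m] m_gt0 hom_fin split_idem addX addT _ _ boundT ctT _ _ indecT
  disjXY x.
exact: kernel_generated.
Qed.
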